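(* Let $\mu,L,M,L_2>0$ and let $f:\mathbb{R}^n\to\mathbb{R}$ be three times continuously differentiable, $\mu$-strongly convex, with $L$-Lipschitz continuous gradient, $M$-self-concordant, and with $L_2$-Lipschitz continuous Hessian. Let $\tilde M=L_2/(2\mu^{3/2})$ and assume $M\le\tilde M$. Let $\varkappa=L/\mu$, let $\mathbf{x}_*$ be the unique minimizer of $f$, let $\mathbf{x}_0\in\mathbb{R}^n$, let $\mathbf{B}_0\in\mathbb{R}^{n\times n}$ be symmetric positive definite, and let $(\mathbf{x}_k)_{k\ge0}$ be generated by the adaptive BFGS algorithm with parameter $M$ (with $\nabla f(\mathbf{x}_k)\neq\mathbf{0}$ for all $k$). Put $\Delta=f(\mathbf{x}_0)-f(\mathbf{x}_* )$, $\bar{\mathbf{B}}_0=\mathbf{B}_0/L$ and $\tilde{\mathbf{B}}_0=\nabla^2 f(\mathbf{x}_* )^{-1/2}\,\mathbf{B}_0\,\nabla^2 f(\mathbf{x}_* )^{-1/2}$. Then for all integers $k\ge1$, $$\frac{f(\mathbf{x}_k)-f(\mathbf{x}_* )}{f(\mathbf{x}_0)-f(\mathbf{x}_* )}\le\left(\frac{\Psi(\tilde{\mathbf{B}}_0)+8\sqrt2\,\tilde M\sqrt{\Delta}\,\Bigl(2\Psi(\bar{\mathbf{B}}_0)+4\min\bigl\{(2\ln\varkappa+1)M^2\Delta,\;2\sqrt2\,\varkappa M\sqrt{\Delta}\bigr\}+13\varkappa\Bigr)}{k}\right)^{k}.$$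
   Context: $\|\cdot\|$ is the Euclidean norm for vectors and the spectral norm for matrices, and $\|\mathbf{d}\|_{\mathbf{x}}=(\mathbf{d}^\top\nabla^2 f(\mathbf{x})\mathbf{d})^{1/2}$. The function $f$ is $\mu$-strongly convex if $f(\lambda\mathbf{x}+(1-\lambda)\mathbf{y})\le\lambda f(\mathbf{x})+(1-\lambda)f(\mathbf{y})-\frac{\lambda(1-\lambda)\mu}{2}\|\mathbf{x}-\mathbf{y}\|^2$ for all $\mathbf{x},\mathbf{y}\in\mathbb{R}^n$, $\lambda\in[0,1]$. It has $L$-Lipschitz gradient if $\|\nabla f(\mathbf{x})-\nabla f(\mathbf{y})\|\le L\|\mathbf{x}-\mathbf{y}\|$ for all $\mathbf{x},\mathbf{y}$. A convex $f$ is $M$-self-concordant if $|\nabla^3 f(\mathbf{x})[\mathbf{d},\mathbf{d},\mathbf{d}]|\le 2M\|\mathbf{d}\|_{\mathbf{x}}^3$ for all $\mathbf{x},\mathbf{d}$. It has $L_2$-Lipschitz Hessian if $\|\nabla^2 f(\mathbf{x})-\nabla^2 f(\mathbf{y})\|\le L_2\|\mathbf{x}-\mathbf{y}\|$ for all $\mathbf{x},\mathbf{y}$. For a symmetric positive definite $n\times n$ matrix $\mathbf{A}$, $\Psi(\mathbf{A})=\mathrm{Tr}(\mathbf{A})-\ln\det(\mathbf{A})-n$. Adaptive BFGS algorithm: for $k=0,1,2,\dots$ set $\mathbf{g}_k=\nabla f(\mathbf{x}_k)$, $\mathbf{d}_k=-\mathbf{B}_k^{-1}\mathbf{g}_k$,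 $$t_k=-\frac{\mathbf{g}_k^\top\mathbf{d}_k}{\|\mathbf{d}_k\|_{\mathbf{x}_k}\bigl(\|\mathbf{d}_k\|_{\mathbf{x}_k}-M\mathbf{g}_k^\top\mathbf{d}_k\bigr)},$$ $\mathbf{x}_{k+1}=\mathbf{x}_k+t_k\mathbf{d}_k$, $\mathbf{s}_k=t_k\mathbf{d}_k$, $\mathbf{y}_k=\nabla f(\mathbf{x}_{k+1})-\nabla f(\mathbf{x}_k)$, and $$\mathbf{B}_{k+1}=\mathbf{B}_k-\frac{\mathbf{B}_k\mathbf{s}_k\mathbf{s}_k^\top\mathbf{B}_k}{\mathbf{s}_k^\top\mathbf{B}_k\mathbf{s}_k}+\frac{\mathbf{y}_k\mathbf{y}_k^\top}{\mathbf{y}_k^\top\mathbf{s}_k}.$$ *)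

(* Defs.v *)
From HB Require Import structures.
From mathcomp Require Import all_boot all_order all_algebra.
From mathcomp Require Import all_classical all_reals all_analysis.

Set Implicit Arguments.
Unset Strict Implicit.
Unset Printing Implicit Defensive.

Import Order.TTheory GRing.Theory Num.Theory.
Import numFieldNormedType.Exports.

Local Open Scope classical_set_scope.
Local Open Scope ring_scope.

Section LinearAlgebra.
Context {R : realType} {n : nat}.
Implicit Types (u v : 'cV[R]_n) (A S : 'M[R]_n).

Definition dotv u v : R := (u^T *m v) 0 0.

(* The library norm on ['cV[R]_n] is the sup norm; it induces the same
   topology, but the quantitative bounds need the Euclidean one. *)
Definition enorm v : R := Num.sqrt (dotv v v).

(* Operator norm induced by [enorm].  The closed unit ball is used rather than
   the unit sphere so that the set is nonempty for every [n]. *)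
Definition spectral_norm A : R :=
  sup [set enorm (A *m v) | v in [set v | enorm v <= 1]].

Definition posdef A : Prop :=
  A^T = A /\ forall v, v != 0 -> 0 < dotv v (A *m v).

(* The positive definite square root; it is [0] if there is none, which does not
   happen for a positive definite [A]. *)
Definition sqrtmx A : 'M[R]_n := xget 0 [set S | posdef S /\ S *m S = A].

Definition Psi A : R := \tr A - ln (\det A) - n%:R.

End LinearAlgebra.

Section Calculus.
Context {R : realType} {n : nat}.
Implicit Types (f : 'cV[R]_n -> R) (x y d : 'cV[R]_n).

(* [f] is of class C^k: it is differentiable and each of its directional
   derivatives is of class C^(k-1). *)
Fixpoint Ck (k : nat) f : Prop :=
  if k is k'.+1 then
    (forall x, differentiable f x) /\ (forall d, Ck k' ('D_d f))
  else continuous f.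

Definition basisv (i : 'I_n) : 'cV[R]_n := delta_mx i 0.

Definition grad f x : 'cV[R]_n := \col_i 'D_(basisv i) f x.

Definition hess f x : 'M[R]_n :=
  \matrix_(i, j) 'D_(basisv i) ('D_(basisv j) f) x.

Definition deriv3 f x d : R :=
  \sum_i \sum_j \sum_k
    'D_(basisv i) ('D_(basisv j) ('D_(basisv k) f)) x
      * d i 0 * d j 0 * d k 0.

Definition local_norm f x d : R := Num.sqrt (dotv d (hess f x *m d)).

Definition strongly_convex (mu : R) f : Prop :=
  forall x y (l : R), 0 <= l <= 1 ->
    f (l *: x + (1 - l) *: y)
      <= l * f x + (1 - l) * f y - l * (1 - l) * mu / 2 * enorm (x - y) ^+ 2.

Definition lipschitz_grad (L : R) f : Prop :=
  forall x y, enorm (grad f x - grad f y) <= L * enorm (x - y).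

Definition lipschitz_hess (L2 : R) f : Prop :=
  forall x y, spectral_norm (hess f x - hess f y) <= L2 * enorm (x - y).

Definition self_concordant (M : R) f : Prop :=
  convex_function setT (f : 'cV[R]_n -> R^o) /\
  forall x d, `|deriv3 f x d| <= 2 * M * local_norm f x d ^+ 3.

End Calculus.

Section AdaptiveBFGS.
Context {R : realType} {n : nat}.
Variables (f : 'cV[R]_n -> R) (M : R).

Definition bfgs_update (B : 'M[R]_n) (s y : 'cV[R]_n) : 'M[R]_n :=
  B - (dotv s (B *m s))^-1 *: (B *m s *m s^T *m B)
    + (dotv y s)^-1 *: (y *m y^T).

Definition bfgs_dir (x : 'cV[R]_n) (B : 'M[R]_n) : 'cV[R]_n :=
  - (invmx B *m grad f x).

Definition adaptive_step (x d : 'cV[R]_n) : R :=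
  - (dotv (grad f x) d
       / (local_norm f x d * (local_norm f x d - M * dotv (grad f x) d))).

Definition abfgs_step (xB : 'cV[R]_n * 'M[R]_n) : 'cV[R]_n * 'M[R]_n :=
  let: (x, B) := xB in
  let d := bfgs_dir x B in
  let s := adaptive_step x d *: d in
  let x' := x + s in
  (x', bfgs_update B s (grad f x' - grad f x)).

Definition abfgs (x0 : 'cV[R]_n) (B0 : 'M[R]_n) (k : nat) : 'cV[R]_n :=
  (iter k abfgs_step (x0, B0)).1.

End AdaptiveBFGS.

(* Main.v *)
Require Import Defs.
From HB Require Import structures.
From mathcomp Require Import all_boot all_order all_algebra.
From mathcomp Require Import all_classical all_reals all_analysis.
From mathcomp Require Import complex ring lra.
Import Order.TTheory GRing.Theory Num.Theory.
Import numFieldNormedType.Exports.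
Local Open Scope classical_set_scope.
Local Open Scope ring_scope.

(** Write [F_k = f x_k - f xs], [rho_k = - g_k . d_k] and
[eta_k = M rho_k / ||d_k||_{x_k}].  Self-concordance along the search line
gives [F_k - F_{k+1} >= (eta_k - ln (1 + eta_k)) / M^2], and, combined with the
resulting lower bound on [y_k . s_k],
[F_k - F_{k+1} >= t_k^2 rho_k^2 / (2 (1 + 2 eta_k) y_k . s_k)].

For a positive definite [W], put
[p_k = t_k^2 rho_k^2 / ((g_k . W g_k) (y_k . s_k))].  The BFGS update changes
[Psi (W B)] by at most [Lam - 1 + ln p_k] as soon as
[y_k . W y_k <= Lam y_k . s_k], and if the Hessian dominates [W^-1 / K] between
[x_k] and [xs] then [p_k F_k <= K (1 + 2 eta_k) (F_k - F_{k+1})].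

With [W = 1 / L] one can take [Lam = 1] and [K = L / mu]; weighting the
potential inequality by [sqrt F_k] and summing by parts bounds
[\sum_k sqrt (F_k / F_0)].  With [W] the inverse Hessian at [xs] one can take
[Lam = K = 1 + C_k] for [C_k] proportional to [sqrt F_k], which gives
[F_{k+1} / F_k <= Psi (W B_k) - Psi (W B_{k+1}) + 3 C_k].  Summing these
ratios, using the first bound for the errors, and the AM-GM inequality
conclude. *)

(** * Self-concordant functions on a line *)

(** Comparison tool for the scalar inequalities that follow: the difference of the two sides is
    taken as [h] and its derivative shown nonnegative. *)
Lemma le_is_derive_ge0 (R : realType) (h dh : R -> R) (a b : R) :
  a <= b ->
  (forall x, a <= x <= b -> is_derive x 1 h (dh x)) ->
  (forall x, a <= x <= b -> 0 <= dh x) -> h a <= h b.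
Proof.
move=> ab dhP dh0.
have [||c] := @MVT_segment R h dh a b ab.
- by move=> x; rewrite in_itv /= => /andP[ax xb]; apply: dhP; rewrite !ltW.
- apply: derivable_within_continuous => x; rewrite in_itv /= => xab.
  by have [] := dhP x xab.
rewrite in_itv /= => cab /eqP; rewrite subr_eq => /eqP ->.
by rewrite lerDr mulr_ge0 ?subr_ge0 // dh0.
Qed.

Lemma is_derive_inv_sqrt (R : realType) (v : R -> R) (x dv : R) :
  0 < v x -> is_derive x 1 v dv ->
  is_derive x 1 (fun t => (Num.sqrt (v t))^-1)
    (- (dv / (2 * Num.sqrt (v x) ^+ 3))).
Proof.
move=> vx dvx.
have sx : 0 < Num.sqrt (v x) by rewrite sqrtr_gt0.
have ds : is_derive x 1 (fun t => Num.sqrt (v t)) ((2 * Num.sqrt (v x))^-1 * dv).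
  by apply: (@is_derive1_comp R Num.sqrt v); exact: is_derive1_sqrt.
have := @is_deriveV R (fun t => Num.sqrt (v t)) x _ 1 (lt0r_neq0 sx) ds.
move=> /is_derive_eq; apply.
rewrite /GRing.scale /=; field; exact: lt0r_neq0.
Qed.

Section SelfConcordantLine.
Context {R : realType}.
Variables (p p1 p2 p3 : R -> R) (M T : R).
Hypothesis M0 : 0 < M.
Hypothesis T0 : 0 <= T.
Hypothesis dp : forall x : R, is_derive x 1 p (p1 x).
Hypothesis dp1 : forall x : R, is_derive x 1 p1 (p2 x).
Hypothesis dp2 : forall x : R, is_derive x 1 p2 (p3 x).
Hypothesis p2_gt0 : forall x, 0 < p2 x.
Hypothesis p3_le : forall x, `|p3 x| <= 2 * M * Num.sqrt (p2 x) ^+ 3.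

Let d : R := Num.sqrt (p2 0).

Let d_gt0 : 0 < d. Proof. by rewrite sqrtr_gt0. Qed.

(* Self-concordance says that [p2^(-1/2)] is [M]-Lipschitz. *)
Let inv_sqrt_bound (x : R) : 0 <= x ->
  d^-1 - M * x <= (Num.sqrt (p2 x))^-1 <= d^-1 + M * x.
Proof.
move=> x0.
have sx t : 0 < Num.sqrt (p2 t) by rewrite sqrtr_gt0.
pose r t := p3 t / (2 * Num.sqrt (p2 t) ^+ 3).
have rM t : `|r t| <= M.
  have s3 : 0 < 2 * Num.sqrt (p2 t) ^+ 3 by rewrite mulr_gt0 ?exprn_gt0.
  rewrite normrM normfV (gtr0_norm s3) ler_pdivrMr //.
  by rewrite mulrCA mulrA.
have D (t : R) : is_derive t 1 (fun u => (Num.sqrt (p2 u))^-1) (- r t).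
  exact: is_derive_inv_sqrt.
apply/andP; split.
- have := @le_is_derive_ge0 R (fun t => (Num.sqrt (p2 t))^-1 + M * t)
    (fun t => - r t + M) 0 x x0.
  rewrite mulr0 addr0 -lerBlDr; apply.
  + move=> t _; apply: is_deriveD.
    apply: is_derive_eq; rewrite /GRing.scale /=; ring.
  + by move=> t _; have := rM t; rewrite ler_norml => /andP[_]; lra.
- have := @le_is_derive_ge0 R (fun t => M * t - (Num.sqrt (p2 t))^-1)
    (fun t => M - - r t) 0 x x0.
  rewrite mulr0 sub0r -/d => H.
  have -> // : (forall a b c : R, - a <= b - c -> c <= a + b) by move=> *; lra.
  apply: H.
  + move=> t _; apply: is_deriveB.
    apply: is_derive_eq; rewrite /GRing.scale /=; ring.
  + by move=> t _; have := rM t; rewrite ler_norml => /andP[+ _]; lra.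
Qed.

Let sqrE (x : R) : p2 x = ((Num.sqrt (p2 x))^-1) ^- 2.
Proof. by rewrite exprVn invrK sqr_sqrtr // ltW. Qed.

Lemma sc_line_hess_lower (x : R) : 0 <= x -> d ^+ 2 / (1 + M * d * x) ^+ 2 <= p2 x.
Proof.
move=> x0; have /andP[_ h] := inv_sqrt_bound x x0.
have e0 : 0 < 1 + M * d * x by rewrite ltr_wpDr // !mulr_ge0 // ltW.
have -> : d ^+ 2 / (1 + M * d * x) ^+ 2 = (d^-1 + M * x) ^- 2.
  by field; rewrite -/d !gt_eqF //=; have := e0; lra.
rewrite [leRHS]sqrE lef_pV2 ?posrE ?exprn_gt0 //.
- by rewrite lerXn2r ?nnegrE // ?invr_ge0 ?sqrtr_ge0 // addr_ge0 ?invr_ge0 ?mulr_ge0 // ltW.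
- by rewrite ltr_wpDr ?invr_gt0 // mulr_ge0 // ltW.
- by rewrite invr_gt0 sqrtr_gt0.
Qed.

(** The lower bound [d^-1 - M x] on [p2^(-1/2)] can be inverted only while it is positive, hence the
    restriction on [x]. *)
Lemma sc_line_hess_upper (x : R) : 0 <= x -> M * d * x < 1 ->
  p2 x <= d ^+ 2 / (1 - M * d * x) ^+ 2.
Proof.
move=> x0 x1; have /andP[h _] := inv_sqrt_bound x x0.
have e0 : 0 < 1 - M * d * x by rewrite subr_gt0.
have e1 : 0 < d^-1 - M * x.
  have -> : d^-1 - M * x = d^-1 * (1 - M * d * x) by field; rewrite gt_eqF.
  by rewrite mulr_gt0 ?invr_gt0.
have -> : d ^+ 2 / (1 - M * d * x) ^+ 2 = (d^-1 - M * x) ^- 2.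
  by field; rewrite !gt_eqF //=; have := e0; lra.
rewrite [leLHS]sqrE lef_pV2 ?posrE ?exprn_gt0 ?invr_gt0 ?sqrtr_gt0 //.
by rewrite lerXn2r ?nnegrE // ?invr_ge0 ?sqrtr_ge0 // ltW.
Qed.

Let is_derive_affine (c t : R) : is_derive t 1 (fun u => 1 + c * u) c.
Proof. apply: is_derive_eq; rewrite /GRing.scale /=; ring. Qed.

Let is_derive_inv_affine (c t : R) : 1 + c * t != 0 ->
  is_derive t 1 (fun u => (1 + c * u)^-1) (- (c / (1 + c * t) ^+ 2)).
Proof.
move=> h; have := @is_deriveV R (fun u => 1 + c * u) t _ 1 h (is_derive_affine c t).
move=> /is_derive_eq; apply; rewrite /GRing.scale /=; field; exact: h.
Qed.

(** The left side is the integral of [d^2 / (1 + c u)^2] over [[0, t]]; the right side is the form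
    that is easy to differentiate. It serves with [c = M d] for the lower gradient bound and
    [c = - M d] for the upper one. *)
Let frac_affineE (c t : R) : c != 0 -> 1 + c * t != 0 ->
  t * d ^+ 2 / (1 + c * t) = d ^+ 2 / c * (1 - (1 + c * t)^-1).
Proof. by move=> c0 h; field; rewrite c0 h. Qed.

Let is_derive_frac_affine (c t : R) : c != 0 -> 1 + c * t != 0 ->
  is_derive t 1 (fun u => d ^+ 2 / c * (1 - (1 + c * u)^-1))
    (d ^+ 2 / (1 + c * t) ^+ 2).
Proof.
move=> c0 h; have := is_derive_inv_affine c t h => H.
apply: is_derive_eq; rewrite /GRing.scale /=; field; by rewrite c0 h.
Qed.

Lemma sc_line_grad_lower : T * d ^+ 2 / (1 + M * d * T) <= p1 T - p1 0.
Proof.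
have c0 : M * d != 0 by rewrite mulf_neq0 // gt_eqF.
have e0 (x : R) : 0 <= x -> 1 + M * d * x != 0.
  by move=> x0; rewrite gt_eqF // ltr_wpDr // !mulr_ge0 // ltW.
rewrite frac_affineE ?e0 //.
have := @le_is_derive_ge0 R
  (fun t => p1 t - d ^+ 2 / (M * d) * (1 - (1 + M * d * t)^-1))
  (fun t => p2 t - d ^+ 2 / (1 + M * d * t) ^+ 2) 0 T T0.
rewrite mulr0 addr0 invr1 subrr mulr0 subr0 => H.
rewrite lerBrDl -lerBrDr; apply: H => x /andP[x0 _].
- by apply: is_deriveB; apply: is_derive_frac_affine => //; apply: e0.
- by rewrite subr_ge0 sc_line_hess_lower.
Qed.

Lemma sc_line_grad_upper (x : R) : 0 <= x -> M * d * x < 1 ->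
  p1 x - p1 0 <= x * d ^+ 2 / (1 - M * d * x).
Proof.
move=> x0 x1.
have Md0 : 0 <= M * d by rewrite mulr_ge0 // ltW.
have c0 : - (M * d) != 0 by rewrite oppr_eq0 mulf_neq0 // gt_eqF.
have l1 y : y <= x -> M * d * y < 1.
  by move=> yx; apply: le_lt_trans x1; apply: ler_wpM2l.
have e0 y : y <= x -> 1 + - (M * d) * y != 0.
  by move=> /l1 h; rewrite mulNr gt_eqF // subr_gt0.
have -> : 1 - M * d * x = 1 + - (M * d) * x by rewrite mulNr.
rewrite frac_affineE ?e0 //.
have := @le_is_derive_ge0 R
  (fun t => d ^+ 2 / - (M * d) * (1 - (1 + - (M * d) * t)^-1) - p1 t)
  (fun t => d ^+ 2 / (1 + - (M * d) * t) ^+ 2 - p2 t) 0 x x0.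
rewrite mulr0 addr0 invr1 subrr mulr0 sub0r => H.
have -> // : (forall a b c : R, - a <= b - c -> c - a <= b) by move=> *; lra.
apply: H => y /andP[y0 yx].
- by apply: is_deriveB; apply: is_derive_frac_affine => //; apply: e0.
- by rewrite subr_ge0 mulNr sc_line_hess_upper // l1.
Qed.

(** A second integration: the last term has derivative [t d^2 / (1 - M d t)] at [t], which is the
    bound of [sc_line_grad_upper]. *)
Lemma sc_line_upper : M * d * T < 1 ->
  p T <= p 0 + T * p1 0 + (- (M * d * T) - ln (1 - M * d * T)) / M ^+ 2.
Proof.
move=> T1.
have Md0 : 0 <= M * d by rewrite mulr_ge0 // ltW.
have l1 y : y <= T -> 0 < 1 + - (M * d) * y.
  by move=> yx; rewrite mulNr subr_gt0; apply: le_lt_trans T1; apply: ler_wpM2l.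
have := @le_is_derive_ge0 R
  (fun t => t * p1 0 + (- (M * d * t) - ln (1 + - (M * d) * t)) / M ^+ 2 - p t)
  (fun t => p1 0 + t * d ^+ 2 / (1 - M * d * t) - p1 t) 0 T T0.
rewrite !mulr0 mul0r oppr0 addr0 ln1 subrr mul0r addr0 sub0r mulNr => H.
rewrite -addrA; have -> // : (forall a b c e : R, - a <= b + c - e -> e <= a + (b + c)) by move=> *; lra.
apply: H => y /andP[y0 yx].
- have h := l1 y yx.
  have dl : is_derive y 1 (fun u => ln (1 + - (M * d) * u)) ((1 + - (M * d) * y)^-1 * - (M * d)).
    apply: (@is_derive1_comp R (@ln R) (fun u => 1 + - (M * d) * u)); first exact: is_derive1_ln.
    exact: is_derive_affine.
  apply: is_derive_eq; rewrite /GRing.scale /=; field.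
  have h' : 0 < 1 - M * d * y by rewrite -mulNr.
  by rewrite !gt_eqF.
- have := sc_line_grad_upper y y0; have := l1 y yx; rewrite mulNr subr_gt0 => h /(_ h).
  by rewrite lerBlDl subr_ge0.
Qed.
End SelfConcordantLine.

(** * The adaptive step *)

Lemma ln1D_le (R : realType) (x : R) : 0 <= x -> ln (1 + x) <= x.
Proof. by move=> x0; apply: le_ln1Dx; rewrite (lt_le_trans _ x0) // ltrN10. Qed.

Lemma ln_leB1 (R : realType) (x : R) : 0 < x -> ln x <= x - 1.
Proof.
by move=> x0; have := @le_ln1Dx R (x - 1); rewrite addrCA subrr addr0; apply; rewrite ltrBrDr addNr.
Qed.

(** The standard decrease function of self-concordant analysis, Legendre dual to the function
    [- x - ln (1 - x)] of [sc_line_upper]. *)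
Definition omega {R : realType} (e : R) : R := e - ln (1 + e).

Lemma omega0 (R : realType) : omega (0 : R) = 0.
Proof. by rewrite /omega addr0 ln1 subrr. Qed.

Lemma omega_ge0 (R : realType) (e : R) : 0 <= e -> 0 <= omega e.
Proof. by move=> e0; rewrite subr_ge0 ln1D_le. Qed.

Lemma is_derive_ln1D (R : realType) (x : R) : 0 <= x ->
  is_derive x 1 (fun u => ln (1 + u)) (1 + x)^-1.
Proof.
move=> x0.
have da : is_derive x 1 (fun u => 1 + u) (1 : R).
  by apply: is_derive_eq; rewrite add0r mulr1.
rewrite -[(1 + x)^-1]mulr1.
apply: (@is_derive1_comp R (@ln R) (fun u => 1 + u)) => //.
by apply: is_derive1_ln; rewrite ltr_wpDr.
Qed.

(** A rational minorant, quadratic near 0 and linear at infinity, that turns the decrease of a step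
    into an expression in [rho] and [d]. *)
Lemma omega_lower_frac (R : realType) (e : R) : 0 <= e ->
  e ^+ 2 / (2 * (1 + e)) <= omega e.
Proof.
move=> e0; rewrite -subr_ge0.
have := @le_is_derive_ge0 R
  (fun u => omega u - u ^+ 2 / (2 * (1 + u)))
  (fun u => u ^+ 2 / (2 * (1 + u) ^+ 2)) 0 e e0.
rewrite omega0 ?addr0 ?ln1 expr0n mul0r !subr0; apply => x /andP[x0 _].
- have xn : 1 + x != 0 by rewrite gt_eqF // ltr_wpDr.
  have dl := is_derive_ln1D R x x0.
  have dv : is_derive x 1 (fun u => (2 * (1 + u))^-1) (- (2 * (1 + x) ^+ 2)^-1).
    have nz : 2 * (1 + x) != 0 by rewrite mulf_neq0.
    have da : is_derive x 1 (fun u => 2 * (1 + u)) (2 : R).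
      by apply: is_derive_eq; rewrite /GRing.scale /=; ring.
    have := @is_deriveV R (fun u => 2 * (1 + u)) x _ 1 nz da.
    by move=> /is_derive_eq; apply; rewrite /GRing.scale /=; field.
  by apply: is_derive_eq; rewrite /GRing.scale /=; field.
- by rewrite divr_ge0 ?sqr_ge0 // mulr_ge0 ?sqr_ge0.
Qed.

(** The difference of the two sides has derivative [omega u / (1 + u)]. The bound controls
    [ln (1 + e)] by the square root of a decrease, whatever the size of [e]. *)
Lemma omega_lower_ln (R : realType) (e : R) : 0 <= e ->
  ln (1 + e) ^+ 2 / 2 <= omega e.
Proof.
move=> e0; rewrite -subr_ge0.
have := @le_is_derive_ge0 R
  (fun u => omega u - ln (1 + u) ^+ 2 / 2)
  (fun u => omega u / (1 + u)) 0 e e0.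
rewrite omega0 ?addr0 ?ln1 expr0n mul0r !subr0; apply => x /andP[x0 _].
- have xn : 1 + x != 0 by rewrite gt_eqF // ltr_wpDr.
  have dl := is_derive_ln1D R x x0.
  by apply: is_derive_eq; rewrite /omega /GRing.scale /=; field.
- by rewrite divr_ge0 ?omega_ge0 // addr_ge0.
Qed.

Lemma omega_lower_affine (R : realType) (e : R) : 0 <= e ->
  1 + 2 * e <= 3 + 4 * omega e.
Proof.
move=> e0.
(* The tangent of [ln] at 2, together with [ln 2 <= 1], gives [ln (1 + e) <= (1 + e) / 2], which is
   the claim rearranged. *)
have h1 : 0 < (1 + e) / 2 by rewrite divr_gt0 // ltr_wpDr.
have := @ln_leB1 R _ h1; rewrite lnM ?posrE ?invr_gt0 ?ltr_wpDr // lnV ?posrE //.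
have : ln (2 : R) <= 1 by have := @ln1D_le R 1 ler01; rewrite -[1 + 1]/(2%:R).
by rewrite /omega; lra.
Qed.

Section AdaptiveStepLine.
Context {R : realType}.
Variables (p p1 p2 p3 : R -> R) (M rho : R).
Hypothesis M0 : 0 < M.
Hypothesis rho0 : 0 < rho.
Hypothesis dp : forall x : R, is_derive x 1 p (p1 x).
Hypothesis dp1 : forall x : R, is_derive x 1 p1 (p2 x).
Hypothesis dp2 : forall x : R, is_derive x 1 p2 (p3 x).
Hypothesis p2_gt0 : forall x, 0 < p2 x.
Hypothesis p3_le : forall x, `|p3 x| <= 2 * M * Num.sqrt (p2 x) ^+ 3.
Hypothesis p10 : p1 0 = - rho.

Let d : R := Num.sqrt (p2 0).
Let t : R := rho / (d * (d + M * rho)).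
Let eta : R := M * rho / d.

Let d_gt0 : 0 < d. Proof. by rewrite sqrtr_gt0. Qed.
Let s_gt0 : 0 < d + M * rho. Proof. by rewrite addr_gt0 // mulr_gt0. Qed.
Let t_ge0 : 0 <= t. Proof. by rewrite divr_ge0 ?mulr_ge0 // ltW. Qed.
Let eta_ge0 : 0 <= eta. Proof. by rewrite divr_ge0 ?mulr_ge0 // ltW. Qed.

(** The step [t] is the minimizer of the upper model in [sc_line_upper]. This identity shows
    [M d t < 1], so the model applies to it for every [eta]. *)
Let MdtE : M * d * t = 1 - (1 + eta)^-1.
Proof.
rewrite /t /eta; field; rewrite !gt_eqF //.
Qed.

Lemma adaptive_step_line_decrease : omega eta / M ^+ 2 <= p 0 - p t.
Proof.
have e1 : 0 < 1 + eta by rewrite ltr_wpDr.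
have lt1 : M * d * t < 1 by rewrite MdtE ltrBlDr ltrDl invr_gt0.
have := @sc_line_upper R p p1 p2 p3 M t M0 t_ge0 dp dp1 dp2 p2_gt0 p3_le lt1.
rewrite p10 -/d MdtE subKr lnV ?posrE // opprK => H.
rewrite lerBrDl -lerBrDr (le_trans H) // -addrA lerD2l.
rewrite le_eqVlt; apply/orP; left; apply/eqP.
rewrite /omega /t /eta; field; by rewrite !gt_eqF.
Qed.

(** Multiplies the lower bound on the curvature [t (p1 t - p1 0)] by the lower bound on the
    decrease: the powers of [d] and the factors [1 + eta] cancel, and only [1 + 2 eta] remains. *)
Lemma adaptive_step_line_product :
  t ^+ 2 * rho ^+ 2 <= 2 * (1 + 2 * eta) * (t * (p1 t - p1 0)) * (p 0 - p t).
Proof.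
have e1 : 0 < 1 + eta by rewrite ltr_wpDr.
have e2 : 0 < 1 + 2 * eta by rewrite ltr_wpDr // mulr_ge0.
have H1 := @sc_line_grad_lower R p1 p2 p3 M t M0 t_ge0 dp1 dp2 p2_gt0 p3_le.
have H2 := le_trans _ adaptive_step_line_decrease.
have {}H2 : rho ^+ 2 / (2 * d ^+ 2 * (1 + eta)) <= p 0 - p t.
  apply: H2; rewrite ler_pdivlMr ?exprn_gt0 //.
  apply: le_trans (omega_lower_frac _ _ eta_ge0).
  rewrite le_eqVlt; apply/orP; left; apply/eqP.
  by rewrite /eta; field; rewrite !gt_eqF.
have {}H1 : t ^+ 2 * d ^+ 2 * (1 + eta) / (1 + 2 * eta) <= t * (p1 t - p1 0).
  apply: le_trans (ler_wpM2l t_ge0 H1); rewrite -/d MdtE.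
  rewrite le_eqVlt; apply/orP; left; apply/eqP.
  by field; rewrite !gt_eqF //=; have := e1; have := e2; lra.
have -> : t ^+ 2 * rho ^+ 2 = 2 * (1 + 2 * eta) *
   (t ^+ 2 * d ^+ 2 * (1 + eta) / (1 + 2 * eta)) * (rho ^+ 2 / (2 * d ^+ 2 * (1 + eta))).
  by field; rewrite !gt_eqF.
apply: ler_pM => //.
- by rewrite !(sqr_ge0, ltW e1, ltW e2, invr_ge0, mulr_ge0).
- by rewrite !(sqr_ge0, ltW e1, invr_ge0, mulr_ge0)//.
- by rewrite ler_wpM2l // mulr_ge0 // ltW.
Qed.

End AdaptiveStepLine.

(** * Sequences of gaps *)

(** From [1 + 2 e <= 3 + 4 omega e <= l (1 + 4 omega e / l)]; the threshold 3 is the constant of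
    [omega_lower_affine]. The excess of [ln (1 + 2 e)] over [ln l] is thus paid by the decrease of
    the step. *)
Lemma ln1D_double_le (R : realType) (l e : R) : 3 <= l -> 0 <= e ->
  ln (1 + 2 * e) - ln l <= 4 / l * omega e.
Proof.
move=> l3 e0.
have l0 : 0 < l by apply: lt_le_trans l3.
have w0 := @omega_ge0 R e e0.
have e2 : 0 <= 2 * e by rewrite mulr_ge0.
have e1 : 0 < 1 + 2 * e by rewrite ltr_wpDr.
have h0 : 0 <= 4 / l * omega e by rewrite !mulr_ge0 // invr_ge0 ltW.
rewrite lerBlDr; apply: le_trans (lerD (ln1D_le _ _ h0) (lexx _)).
rewrite -lnM ?posrE ?ltr_wpDr // ler_ln ?posrE ?mulr_gt0 ?ltr_wpDr //.
apply: le_trans (omega_lower_affine _ _ e0) _.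
have -> : (1 + 4 / l * omega e) * l = l + 4 * omega e by field; rewrite gt_eqF.
by rewrite lerD2r.
Qed.

Section SqrtGapSum.
Context {R : realType}.
Variables (D e p Ps : nat -> R) (kappa a : R).
Hypothesis kappa0 : 0 < kappa.
Hypothesis D0 : D 0 = 1.
Hypothesis D_ge0 : forall k, 0 < D k.
Hypothesis D_dec : forall k, D k.+1 <= D k.
Hypothesis e_ge0 : forall k, 0 <= e k.
Hypothesis p_gt0 : forall k, 0 < p k.
Hypothesis Ps_ge0 : forall k, 0 <= Ps k.
Hypothesis Ps_step : forall k, Ps k.+1 - Ps k <= ln (p k).
Hypothesis D_step : forall k, p k * D k <= (D k - D k.+1) * (kappa * (1 + 2 * e k)).
Hypothesis e_step : forall k, omega (e k) <= a ^+ 2 * (D k - D k.+1).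

Let D_le1 k : D k <= 1.
Proof. by elim: k => [|k IH]; [rewrite D0 | apply: le_trans IH]. Qed.

(* [1 + ln q <= q] for [q = l p_k / (1 + 2 e_k)], multiplied by [sqrt (D k)];
   the terms in [Ps] are arranged for summation by parts. *)
Let sqrt_gap_step (l : R) k : 3 <= l ->
  Num.sqrt (D k) + Num.sqrt (D k.+1) * Ps k.+1 + 2 * kappa * l * Num.sqrt (D k.+1)
     + 4 * a ^+ 2 / l * D k.+1
  <= Num.sqrt (D k) * Ps k + 2 * kappa * l * Num.sqrt (D k) + 4 * a ^+ 2 / l * D k.
Proof.
move=> l3; have l0 : 0 < l by apply: lt_le_trans l3.
set s := Num.sqrt (D k); set s' := Num.sqrt (D k.+1).
have s0 : 0 < s by rewrite sqrtr_gt0.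
have s'0 : 0 < s' by rewrite sqrtr_gt0.
have ss' : s' <= s by rewrite ler_sqrt // ltW.
have s1 : s <= 1 by rewrite -sqrtr1 ler_sqrt.
have sE : D k = s ^+ 2 by rewrite sqr_sqrtr // ltW.
have s'E : D k.+1 = s' ^+ 2 by rewrite sqr_sqrtr // ltW.
have e1 : 0 < 1 + 2 * e k by rewrite ltr_wpDr // mulr_ge0.
(* The decrease [s^2 - s'^2] is at most [2 s (s - s')], after which one factor [s] cancels and the
   differences of [s] telescope. *)
have h1 : l * p k * s <= 2 * kappa * l * (s - s') * (1 + 2 * e k).
  have H := D_step k; rewrite sE s'E in H.
  have : s * (p k * s) <= s * (2 * kappa * (s - s') * (1 + 2 * e k)).
    have -> : s * (p k * s) = p k * s ^+ 2 by ring.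
    apply: le_trans H _.
    have -> : s * (2 * kappa * (s - s') * (1 + 2 * e k)) =
      (2 * s * (s - s')) * (kappa * (1 + 2 * e k)) by ring.
    apply: ler_wpM2r; first by rewrite mulr_ge0 // ltW.
    rewrite -subr_ge0.
    have -> : 2 * s * (s - s') - (s ^+ 2 - s' ^+ 2) = (s - s') ^+ 2 by ring.
    exact: sqr_ge0.
  rewrite ler_pM2l // => /(ler_wpM2l (ltW l0)).
  have -> : l * p k * s = l * (p k * s) by ring.
  by have -> : 2 * kappa * l * (s - s') * (1 + 2 * e k) = l * (2 * kappa * (s - s') * (1 + 2 * e k)) by ring.
have h2 : 1 + ln (p k) + ln l - ln (1 + 2 * e k) <= l * p k / (1 + 2 * e k).
  have q0 : 0 < l * p k / (1 + 2 * e k) by rewrite divr_gt0 // mulr_gt0.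
  have := @ln_leB1 R _ q0.
  by rewrite !lnM ?posrE ?mulr_gt0 ?invr_gt0 // lnV ?posrE //; lra.
have h3 : s * (1 + ln (p k) + ln l - ln (1 + 2 * e k)) <= 2 * kappa * l * (s - s').
  apply: le_trans (ler_wpM2l (ltW s0) h2) _.
  by rewrite mulrA ler_pdivrMr // [s * _]mulrC.
(* Bounding the weight [s] by 1 here leaves a multiple of the decrease, which telescopes. *)
have h4 : s * (ln (1 + 2 * e k) - ln l) <= 4 * a ^+ 2 / l * (D k - D k.+1).
  have w0 := omega_ge0 _ _ (e_ge0 k).
  have H4 : ln (1 + 2 * e k) - ln l <= 4 / l * omega (e k) by apply: ln1D_double_le.
  apply: le_trans (ler_wpM2l (ltW s0) H4) _.
  have q0 : 0 <= 4 / l * omega (e k) by rewrite !mulr_ge0 // invr_ge0 ltW.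
  apply: le_trans (ler_wpM2r q0 s1) _.
  have -> : 4 * a ^+ 2 / l * (D k - D k.+1) = 4 / l * (a ^+ 2 * (D k - D k.+1)) by ring.
  by rewrite mul1r ler_wpM2l // mulr_ge0 // invr_ge0 ltW.
have h5 : s * (Ps k.+1 - Ps k) <= s * ln (p k) by rewrite ler_wpM2l // ltW.
have h6 : s' * Ps k.+1 <= s * Ps k.+1 by rewrite ler_wpM2r.
rewrite -/s -/s'; move: h3 h4 h5 h6; rewrite !mulrBr !mulrDr; lra.
Qed.

Lemma sum_sqrt_gap (l : R) (N : nat) : 3 <= l ->
  \sum_(k < N) Num.sqrt (D k) <= Ps 0 + 2 * kappa * l + 4 * a ^+ 2 / l.
Proof.
move=> l3; have l0 : 0 < l by apply: lt_le_trans l3.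
have c0 : 0 <= 4 * a ^+ 2 / l by rewrite !(sqr_ge0, invr_ge0, ltW l0, mulr_ge0).
(* The nonnegative boundary terms at [N] are kept so that the induction telescopes, and dropped at
   the end. *)
suff : \sum_(k < N) Num.sqrt (D k) + Num.sqrt (D N) * Ps N
   + 2 * kappa * l * Num.sqrt (D N) + 4 * a ^+ 2 / l * D N
   <= Ps 0 + 2 * kappa * l + 4 * a ^+ 2 / l.
  apply: le_trans; rewrite -!addrA lerDl !addr_ge0 //.
  - by rewrite mulr_ge0 ?sqrtr_ge0.
  - by rewrite !mulr_ge0 ?sqrtr_ge0 // ltW.
  - by rewrite mulr_ge0 // ltW.
elim: N => [|N IH].
  by rewrite big_ord0 D0 sqrtr1 add0r !mulr1 mul1r.
rewrite big_ord_recr /=.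
have H := @sqrt_gap_step l N l3.
move: H IH; set X := \sum_(i < N) _; lra.
Qed.

End SqrtGapSum.

(** With [q = p / ((1 + C) (1 + 2 e))] the ratio is at most [1 - q <= - ln q]. The three units of
    [C] pay for [ln (1 + C)], for [ln (1 + 2 e)] and for the error in the potential step. *)
Lemma gap_ratio_step (R : realType) (F F' p e C Ph Ph' : R) :
  0 < F -> 0 < p -> 0 <= e -> 0 <= C ->
  p * F <= (F - F') * ((1 + C) * (1 + 2 * e)) ->
  ln (1 + 2 * e) <= C -> Ph' - Ph <= C + ln p ->
  F' / F <= Ph - Ph' + 3 * C.
Proof.
move=> F0 p0 e0 C0 H He HPh.
have K0 : 0 < 1 + C by rewrite ltr_wpDr.
have e2 : 0 <= 2 * e by rewrite mulr_ge0.
have e1 : 0 < 1 + 2 * e by rewrite ltr_wpDr.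
pose q := p / ((1 + C) * (1 + 2 * e)).
have q0 : 0 < q by rewrite divr_gt0 // mulr_gt0.
have h1 : F' / F <= 1 - q.
  rewrite ler_pdivrMr // mulrBl mul1r lerBrDl -lerBrDr.
  by rewrite /q mulrAC ler_pdivrMr // mulr_gt0.
have h2 : ln q <= q - 1 by apply: ln_leB1.
have h3 : ln q = ln p - (ln (1 + C) + ln (1 + 2 * e)).
  by rewrite /q lnM ?posrE ?invr_gt0 ?mulr_gt0 // lnV ?posrE ?mulr_gt0 // lnM ?posrE.
have h4 : ln (1 + C) <= C by apply: ln1D_le.
move: h1 h2 h3 h4 He HPh; lra.
Qed.

Lemma gap_product_le (R : realType) (F : nat -> R) (k : nat) (S : R) :
  (forall i, 0 < F i) -> (0 < k)%N ->
  \sum_(i < k) F i.+1 / F i <= S -> F k / F 0 <= (S / k%:R) ^+ k.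
Proof.
move=> F0 k0 HS.
have -> : F k / F 0 = \prod_(i < k) (F i.+1 / F i).
  elim: {HS} k k0 => // -[|k] IH _.
    by rewrite big_ord_recl big_ord0 mulr1.
  rewrite big_ord_recr /= -IH //; field; by rewrite !gt_eqF.
have := @leif_AGM R 'I_k predT (fun i : 'I_k => F i.+1 / F i).
rewrite card_ord => -[|+ _]; first by move=> i _; rewrite divr_ge0 // ltW.
move=> /le_trans; apply.
rewrite lerXn2r ?nnegrE ?divr_ge0 ?sumr_ge0 //.
- by move=> i _; rewrite divr_ge0 // ltW.
- by apply: le_trans HS; rewrite sumr_ge0 // => i _; rewrite divr_ge0 // ltW.
- by rewrite ler_pM2r // invr_gt0 ltr0n.
Qed.

(** * Positive definite matrices *)

Section Dot.
Context {R : realType} {n : nat}.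
Implicit Types (u v w : 'cV[R]_n) (A : 'M[R]_n).

Lemma dotvE u v : dotv u v = \sum_i u i 0 * v i 0.
Proof. by rewrite /dotv mxE; apply: eq_bigr => i _; rewrite mxE. Qed.

Lemma dotvC u v : dotv u v = dotv v u.
Proof. by rewrite !dotvE; apply: eq_bigr => i _; rewrite mulrC. Qed.

Lemma dotvDl u v w : dotv (u + v) w = dotv u w + dotv v w.
Proof. by rewrite /dotv linearD mulmxDl mxE. Qed.

Lemma dotvDr u v w : dotv w (u + v) = dotv w u + dotv w v.
Proof. by rewrite /dotv mulmxDr mxE. Qed.

Lemma dotvNl u w : dotv (- u) w = - dotv u w.
Proof. by rewrite /dotv linearN mulNmx mxE. Qed.

Lemma dotvNr u w : dotv w (- u) = - dotv w u.
Proof. by rewrite /dotv mulmxN mxE. Qed.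

Lemma dotvBl u v w : dotv (u - v) w = dotv u w - dotv v w.
Proof. by rewrite dotvDl dotvNl. Qed.

Lemma dotvBr u v w : dotv w (u - v) = dotv w u - dotv w v.
Proof. by rewrite dotvDr dotvNr. Qed.

Lemma dotvZl a u w : dotv (a *: u) w = a * dotv u w.
Proof. by rewrite /dotv linearZ /= -scalemxAl mxE. Qed.

Lemma dotvZr a u w : dotv w (a *: u) = a * dotv w u.
Proof. by rewrite /dotv -scalemxAr mxE. Qed.

Lemma dotv_mulmxr A u v : dotv u (A *m v) = dotv (A^T *m u) v.
Proof. by rewrite /dotv trmx_mul trmxK mulmxA. Qed.

Lemma dotvv_ge0 u : 0 <= dotv u u.
Proof. by rewrite dotvE sumr_ge0 // => i _; rewrite -expr2 sqr_ge0. Qed.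

Lemma dotvv_gt0 u : u != 0 -> 0 < dotv u u.
Proof.
move=> u0; rewrite lt_def dotvv_ge0 andbT dotvE psumr_eq0.
  apply: contra u0 => /allP h; apply/eqP/colP => i; rewrite mxE.
  by apply/eqP; rewrite -sqrf_eq0 expr2; apply: h; rewrite mem_index_enum.
by move=> i _; rewrite -expr2 sqr_ge0.
Qed.

Lemma enorm_ge0 u : 0 <= enorm u.
Proof. exact: sqrtr_ge0. Qed.

Lemma sqr_enorm u : enorm u ^+ 2 = dotv u u.
Proof. by rewrite sqr_sqrtr // dotvv_ge0. Qed.

Lemma enormZ a u : enorm (a *: u) = `|a| * enorm u.
Proof.
by rewrite /enorm dotvZl dotvZr mulrA -expr2 sqrtrM ?sqr_ge0 // sqrtr_sqr.
Qed.

(** Weighted Young inequality for the form of [A]: expand its value at [a u - v] and divide by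
    [a]. *)
Lemma psd_cross A a u v : A^T = A -> (forall w, 0 <= dotv w (A *m w)) -> 0 < a ->
  2 * dotv u (A *m v) <= a * dotv u (A *m u) + a^-1 * dotv v (A *m v).
Proof.
move=> As A0 a0; have := A0 (a *: u - v).
rewrite mulmxBr -scalemxAr !(dotvBl, dotvBr, dotvZl, dotvZr).
rewrite (dotv_mulmxr A v u) As (dotvC (A *m v)) => H.
rewrite -(ler_pM2l a0) mulrDr [a * (a^-1 * _)]mulrA divff ?gt_eqF // mul1r.
move: H; lra.
Qed.

Lemma dotv_cauchy u v : dotv u v <= enorm u * enorm v.
Proof.
have [->|u0] := eqVneq u 0.
  by rewrite -[0](scale0r 0) dotvZl mul0r mulr_ge0 ?enorm_ge0.
have [->|v0] := eqVneq v 0.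
  by rewrite -[0](scale0r 0) dotvZr mul0r mulr_ge0 ?enorm_ge0.
have eu : 0 < enorm u by rewrite sqrtr_gt0 dotvv_gt0.
have ev : 0 < enorm v by rewrite sqrtr_gt0 dotvv_gt0.
(* This weight makes the two terms on the right of [psd_cross] equal. *)
have := @psd_cross 1%:M (enorm v / enorm u) u v (trmx1 _ _).
rewrite !mul1mx -!sqr_enorm => /(_ _ (divr_gt0 ev eu)) H.
have {}H : 2 * dotv u v <= 2 * (enorm u * enorm v).
  apply: le_trans (H _) _.
    by move=> w; rewrite mul1mx dotvv_ge0.
  rewrite le_eqVlt; apply/orP; left; apply/eqP.
  by field; rewrite !gt_eqF.
by rewrite ler_pM2l in H.
Qed.

End Dot.

(** * Spectral theory of real positive definite matrices *)

Section Spectral.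
Context {R : realType}.

Lemma posdef_eigenvalue_gt0 n (A : 'M[R]_n) a : posdef A -> eigenvalue A a -> 0 < a.
Proof.
move=> [As Ap] /eigenvalueP [v va v0].
have vT0 : v^T != 0 by rewrite -(inj_eq (can_inj (@trmxK _ _ _))) trmxK trmx0.
have := Ap _ vT0.
have -> : A *m v^T = a *: v^T by rewrite -{1}As -trmx_mul va linearZ.
by rewrite dotvZr pmulr_lgt0 // dotvv_gt0.
Qed.

(** The spectral theorem is applied over the complex numbers, where [A] is Hermitian. Only [U] stays
    complex: the eigenvalues are real and positive, so traces, determinants and polynomials in [A]
    descend to [R] by injectivity of the embedding. *)
Lemma posdef_diagonalizable n (A : 'M[R]_n) : posdef A ->
  exists (l : 'rV[R]_n) (U : 'M[R[i]]_n),
  [/\ U \in unitmx, forall i, 0 < l 0 i &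
   map_mx (real_complex R) A =
     invmx U *m diag_mx (map_mx (real_complex R) l) *m U].
Proof.
move=> Apd; have [As Ap] := Apd.
have Ar : map_mx (real_complex R) A \is a mxOver Num.real.
  apply/mxOverP => i j; rewrite mxE; apply/complex_realP; by exists (A i j).
have Ah : map_mx (real_complex R) A \is hermsymmx.
  apply: realsym_hermsym Ar; rewrite qualifE /= expr0 scale1r.
  by rewrite [X in _ == X]map_mx_id // map_trmx As.
have /orthomx_spectralP Asp := hermitian_normalmx Ah.
have /mxOverP lr := hermitian_spectral_diag_real Ah.
set U := spectralmx _ in Asp; set D := spectral_diag _ in Asp lr.
have Uu : U \in unitmx := spectral_unit _.
exists (map_mx (@complex.Re R) D), U.
have DE : map_mx (real_complex R) (map_mx (@complex.Re R) D) = D.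
  by apply/rowP => i; rewrite !mxE; apply: RRe_real; apply: lr.
split; [exact: Uu | | by rewrite DE; exact: Asp].
move=> i; apply: (@posdef_eigenvalue_gt0 n A _ Apd).
rewrite eigenvalue_root_char -(fmorph_root (real_complex R)) map_char_poly -eigenvalue_root_char.
(* Row [i] of [U] is a left eigenvector, and it is nonzero because [U] is invertible. *)
apply/eigenvalueP; exists (row i U).
  rewrite {1}Asp rowE !mulmxA (mulmxK Uu) -[_ *m diag_mx D]rowE row_diag_mx -scalemxAl -rowE.
  by congr (_ *: _); have /rowP /(_ i) := DE; rewrite mxE.
apply/eqP => /(congr1 (mulmx^~ (invmx U))); rewrite rowE mul0mx (mulmxK Uu).
by move=> /rowP /(_ i); rewrite !mxE !eqxx => /eqP; rewrite oner_eq0.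
Qed.

End Spectral.

(** Newton interpolation: a new node is corrected by a multiple of the polynomial vanishing at the
    earlier ones. It makes a function of a matrix a polynomial in it, which keeps real entries and
    symmetry. *)
Lemma interpolation_poly (F : fieldType) (s : seq F) (g : F -> F) :
  exists p : {poly F}, {in s, forall x, p.[x] = g x}.
Proof.
elim: s => [|a s [p pP]]; first by exists 0.
have [ain|aout] := boolP (a \in s).
  by exists p => x; rewrite inE => /predU1P[->|]; exact: pP.
pose q := \prod_(y <- s) ('X - y%:P).
have qa : q.[a] != 0 by rewrite -[_ == 0]/(root q a) root_prod_XsubC.
exists (p + ((g a - p.[a]) / q.[a]) *: q) => x; rewrite inE => /predU1P[->|xs].
  by rewrite hornerD hornerZ divfK // addrC subrK.
have : root q x by rewrite root_prod_XsubC.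
by move=> /eqP qx; rewrite hornerD hornerZ qx mulr0 addr0 pP.
Qed.

Lemma trmx_horner_mx (F : comNzRingType) n (A : 'M[F]_n.+1) (p : {poly F}) :
  A^T = A -> (horner_mx A p)^T = horner_mx A p.
Proof.
move=> As; elim/poly_ind: p => [|p c IH]; first by rewrite rmorph0 trmx0.
rewrite rmorphD rmorphM /= horner_mx_X horner_mx_C linearD /= tr_scalar_mx.
congr (_ + _); rewrite -!mulmxE trmx_mul IH As.
exact: (comm_mx_horner p (erefl (A *m A))).
Qed.

Section SpectralConsequences.
Context {R : realType} {n : nat}.
Implicit Types A B : 'M[R]_n.

Lemma posdef_trace_det A : posdef A ->
  exists l : 'rV[R]_n, [/\ forall i, 0 < l 0 i,
    \tr A = \sum_i l 0 i & \det A = \prod_i l 0 i].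
Proof.
move=> /posdef_diagonalizable [l [U [Uu l0 AE]]]; exists l; split=> //.
- apply: (fmorph_inj (real_complex R)).
  rewrite -trace_map_mx AE mxtrace_mulC mulmxA (mulmxV Uu) mul1mx mxtrace_diag rmorph_sum.
  by apply: eq_bigr => i _; rewrite mxE.
- apply: (fmorph_inj (real_complex R)).
  rewrite -det_map_mx AE !det_mulmx mulrAC -det_mulmx (mulVmx Uu) det1 mul1r det_diag rmorph_prod.
  by apply: eq_bigr => i _; rewrite mxE.
Qed.

Lemma posdef_det_gt0 A : posdef A -> 0 < \det A.
Proof. by move=> /posdef_trace_det [l [l0 _ ->]]; rewrite prodr_gt0. Qed.

Lemma posdef_unit A : posdef A -> A \in unitmx.
Proof. by move=> /posdef_det_gt0 h; rewrite unitmxE unitfE gt_eqF. Qed.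

Lemma ln_prod_le (I : Type) (r : seq I) (F : I -> R) : (forall i, 0 < F i) ->
  ln (\prod_(i <- r) F i) <= \sum_(i <- r) (F i - 1).
Proof.
move=> F0; elim: r => [|i r IH]; first by rewrite !big_nil ln1.
rewrite !big_cons lnM ?posrE ?prodr_gt0 //.
by apply: lerD => //; apply: ln_leB1.
Qed.

(** In terms of the eigenvalues, [Psi A] is the sum of the nonnegative numbers
    [l_i - 1 - ln l_i]. *)
Lemma Psi_ge0 A : posdef A -> 0 <= Psi A.
Proof.
move=> /posdef_trace_det [l [l0 trE detE]]; rewrite /Psi trE detE.
have := @ln_prod_le _ (index_enum 'I_n) (fun i => l 0 i) l0.
rewrite sumrB sumr_const card_ord; lra.
Qed.

Lemma posdef_congr A B : B \in unitmx -> posdef A -> posdef (B^T *m A *m B).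
Proof.
move=> Bu [As Ap]; split; first by rewrite !trmx_mul trmxK As mulmxA.
move=> v v0; rewrite -!mulmxA dotv_mulmxr trmxK; apply: Ap.
by apply: contra_neq v0 => /(congr1 (mulmx (invmx B))); rewrite (mulKmx Bu) mulmx0.
Qed.

Lemma posdef_invmx A : posdef A -> posdef (invmx A).
Proof.
move=> Ap; have Au := posdef_unit _ Ap; have [As _] := Ap.
have -> : invmx A = (invmx A)^T *m A *m invmx A by rewrite trmx_inv As mulVmx // mul1mx.
by apply: posdef_congr => //; rewrite unitmx_inv.
Qed.

End SpectralConsequences.

(* Interpolating the fourth root on the spectrum gives a real symmetric [T] with
   [T^4 = A], so that the root [T^2 = T^T T] is visibly positive. *)
Lemma posdef_sqrt (R : realType) n (A : 'M[R]_n) : posdef A ->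
  exists S : 'M[R]_n, posdef S /\ S *m S = A.
Proof.
case: n A => [|n] A Apd.
  by exists A; split=> //; rewrite [LHS]flatmx0 [RHS]flatmx0.
have [l [U [Uu l0 AE]]] := posdef_diagonalizable _ A Apd.
have [p pP] := interpolation_poly R (map (fun i => l 0 i) (enum 'I_n.+1))
  (fun x => Num.sqrt (Num.sqrt x)).
have {}pP i : (p ^+ 4).[l 0 i] = l 0 i.
  rewrite horner_exp pP; last by rewrite map_f // mem_enum.
  by rewrite (exprM _ 2 2) !sqr_sqrtr ?sqrtr_ge0 // ltW.
pose T := horner_mx A p.
have [As _] := Apd.
have Ts : T^T = T by apply: trmx_horner_mx.
have T4 : (T *m T) *m (T *m T) = A.
  have -> : (T *m T) *m (T *m T) = horner_mx A (p ^+ 4).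
    by rewrite rmorphXn !mulmxE /= !exprS expr0 mulr1 !mulrA.
  apply: (@map_mx_inj _ _ (real_complex R)).
  rewrite map_horner_mx AE horner_mx_uconjC //.
  rewrite horner_mx_diag; congr (_ *m diag_mx _ *m _).
  by apply/rowP => i; rewrite !mxE horner_map pP.
exists (T *m T); split=> //.
have Tu : T \in unitmx.
  have := posdef_unit _ Apd; rewrite -T4 !unitmx_mul.
  by case/andP=> /andP[].
have -> : T *m T = T^T *m 1%:M *m T by rewrite Ts mulmx1.
apply: posdef_congr => //; split; first exact: trmx1.
by move=> v v0; rewrite mul1mx dotvv_gt0.
Qed.

(** * The BFGS update *)

(** Matrix determinant lemma: the products [Lo X] and [X Lo] have the same determinant, and both are
    block upper triangular, one exposing each side. *)
Lemma det_1D_rank1 (F : comNzRingType) n (u v : 'cV[F]_n) :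
  \det (1%:M + u *m v^T) = 1 + (v^T *m u) 0 0.
Proof.
pose Lo : 'M[F]_(n + 1) := block_mx 1%:M 0 v^T 1%:M.
pose X : 'M[F]_(n + 1) := block_mx 1%:M u (- v^T) 1%:M.
have dL : \det Lo = 1 by rewrite det_lblock !det1 mulr1.
have LX : Lo *m X = block_mx 1%:M u 0 (1%:M + v^T *m u).
  by rewrite mulmx_block !(mul1mx, mulmx1, mul0mx, addr0) addrN addrC.
have XL : X *m Lo = block_mx (1%:M + u *m v^T) u 0 1%:M.
  by rewrite mulmx_block !(mul1mx, mulmx1, mulmx0, add0r) addNr.
have : \det (Lo *m X) = \det (X *m Lo) by rewrite !det_mulmx mulrC.
by rewrite LX XL !det_ublock !det1 mul1r mulr1 => <-; rewrite det_mx11 !mxE eqxx.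
Qed.

Section BfgsUpdate.
Context {R : realType} {n : nat}.
Implicit Types (B W : 'M[R]_n) (s y : 'cV[R]_n).

(* The update is a congruence [J B J^T], which yields both its positivity and
   its determinant. *)
Let bfgs_factor B s y : 'M[R]_n :=
  let b := dotv s (B *m s) in
  1%:M + (b^-1 *: (Num.sqrt (b / dotv y s) *: y - B *m s)) *m s^T.

Let bfgs_updateE B s y : B^T = B -> 0 < dotv s (B *m s) -> 0 < dotv y s ->
  bfgs_update B s y = bfgs_factor B s y *m B *m (bfgs_factor B s y)^T.
Proof.
move=> Bs b0 g0; rewrite /bfgs_factor /bfgs_update.
have c2 : Num.sqrt (dotv s (B *m s) / dotv y s) ^+ 2 = dotv s (B *m s) / dotv y s.
  by rewrite sqr_sqrtr // divr_ge0 // ltW.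
have bE : s^T *m (B *m s) = (dotv s (B *m s))%:M by rewrite -mx11_scalar.
move: bE c2 b0 g0; set b := dotv s (B *m s); set g := dotv y s; set c := Num.sqrt _.
move=> bE c2 b0 g0.
have sB : s^T *m B = (B *m s)^T by rewrite trmx_mul Bs.
set z := b^-1 *: (c *: y - B *m s).
have -> : (1%:M + z *m s^T)^T = 1%:M + s *m z^T.
  by rewrite linearD /= trmx1 trmx_mul trmxK.
have -> : (1%:M + z *m s^T) *m B = B + z *m (B *m s)^T.
  by rewrite mulmxDl mul1mx -mulmxA sB.
have -> : (B + z *m (B *m s)^T) *m (1%:M + s *m z^T) =
    B + z *m (B *m s)^T + (B *m s *m z^T + b *: (z *m z^T)).
  rewrite mulmxDr mulmx1; congr (_ + _); rewrite mulmxDl mulmxA; congr (_ + _).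
  by rewrite -sB -!mulmxA (mulmxA s^T) (mulmxA (s^T *m B)) -(mulmxA s^T) bE mul_scalar_mx -scalemxAr.
rewrite -[B *m s *m s^T *m B]mulmxA sB /z.
set w := B *m s.
apply/matrixP => i j; rewrite !mxE !big_ord1 !mxE.
apply/eqP; rewrite -subr_eq0; apply/eqP.
(* The cross terms between [y] and [B s] cancel; what is left is the coefficient of [y y^T], and [c]
   was chosen to make it vanish. *)
transitivity ((g^-1 - b^-1 * c ^+ 2) * (y i 0 * y j 0)); first by field; rewrite !gt_eqF.
by rewrite c2 mulKf ?gt_eqF // subrr mul0r.
Qed.

Let det_bfgs_factor B s y : 0 < dotv s (B *m s) -> 0 < dotv y s ->
  \det (bfgs_factor B s y) ^+ 2 = dotv y s / dotv s (B *m s).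
Proof.
move=> b0 g0; rewrite det_1D_rank1.
have c2 : Num.sqrt (dotv s (B *m s) / dotv y s) ^+ 2 = dotv s (B *m s) / dotv y s.
  by rewrite sqr_sqrtr // divr_ge0 // ltW.
rewrite -/(dotv _ _) dotvZr dotvBr dotvZr (dotvC s y).
move: c2 b0 g0; set b := dotv s (B *m s); set g := dotv y s; set c := Num.sqrt _.
move=> c2 b0 g0.
have -> : 1 + b^-1 * (c * g - b) = c * (g / b) by field; rewrite gt_eqF.
by rewrite exprMn c2; field; rewrite !gt_eqF.
Qed.

Lemma posdef_bfgs_update B s y : posdef B -> s != 0 -> 0 < dotv y s ->
  posdef (bfgs_update B s y).
Proof.
move=> [Bs Bp] /Bp b0 g0; rewrite bfgs_updateE //.
rewrite -{1}[bfgs_factor B s y]trmxK; apply: posdef_congr; last by split.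
rewrite unitmx_tr unitmxE unitfE -[_ == 0]sqrf_eq0 det_bfgs_factor //.
by rewrite gt_eqF // divr_gt0.
Qed.

Lemma det_bfgs_update B s y : posdef B -> s != 0 -> 0 < dotv y s ->
  \det (bfgs_update B s y) = \det B * (dotv y s / dotv s (B *m s)).
Proof.
move=> [Bs Bp] /Bp b0 g0; rewrite bfgs_updateE //.
by rewrite !det_mulmx det_tr mulrAC -expr2 det_bfgs_factor // mulrC.
Qed.

Lemma mxtrace_mulmx_outer W s : \tr (W *m (s *m s^T)) = dotv s (W *m s).
Proof. by rewrite mulmxA mxtrace_mulC /dotv [LHS]big_ord1. Qed.

Lemma Psi_bfgs_update W B s y : posdef W -> posdef B -> s != 0 -> 0 < dotv y s ->
  Psi (W *m bfgs_update B s y) - Psi (W *m B) =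
    dotv y (W *m y) / dotv y s
    - dotv (B *m s) (W *m (B *m s)) / dotv s (B *m s)
    - ln (dotv y s / dotv s (B *m s)).
Proof.
move=> Wp Bp s0 g0; have [Bs /(_ s s0) b0] := Bp.
rewrite /Psi !det_mulmx det_bfgs_update //.
have dW := posdef_det_gt0 _ Wp; have dB := posdef_det_gt0 _ Bp.
have -> : ln (\det W * (\det B * (dotv y s / dotv s (B *m s)))) =
    ln (\det W * \det B) + ln (dotv y s / dotv s (B *m s)).
  by rewrite mulrA [LHS]lnM ?posrE ?mulr_gt0 ?invr_gt0.
have -> : \tr (W *m bfgs_update B s y) = \tr (W *m B)
    - dotv (B *m s) (W *m (B *m s)) / dotv s (B *m s) + dotv y (W *m y) / dotv y s.
  rewrite /bfgs_update mulmxDr mulmxBr linearD linearB /= -!scalemxAr !mxtraceZ.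
  rewrite mxtrace_mulmx_outer.
  have -> : B *m s *m s^T *m B = (B *m s) *m (B *m s)^T by rewrite trmx_mul Bs mulmxA.
  by rewrite mxtrace_mulmx_outer; congr (_ - _ + _); rewrite mulrC.
lra.
Qed.

(** Lets the potential be computed on [W B], which is linear in [B] but not symmetric, while its
    sign is read off the symmetric matrix [S B S]. *)
Lemma Psi_sqrt_congr W B (S : 'M[R]_n) : S *m S = W -> Psi (S *m B *m S) = Psi (W *m B).
Proof.
move=> <-; rewrite /Psi mxtrace_mulC mulmxA !det_mulmx.
by have -> : \det S * \det B * \det S = \det S * \det S * \det B by ring.
Qed.

Lemma Psi_mul_ge0 W B : posdef W -> posdef B -> 0 <= Psi (W *m B).
Proof.
move=> Wp Bp; have [S [Sp SS]] := posdef_sqrt _ _ _ Wp.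
rewrite -(Psi_sqrt_congr W B S SS); apply: Psi_ge0.
have [Ss _] := Sp; rewrite -{1}Ss; apply: posdef_congr => //.
exact: posdef_unit.
Qed.

(** Since [B s = - t g], the trace removed by the update is [r = (g . W g) / rho]. Bounding [- r] by
    [- 1 - ln r] merges it with the logarithm of the determinant ratio into the single logarithm on
    the right. *)
Lemma Psi_bfgs_step W B (g y : 'cV[R]_n) (t Lam : R) :
  let d := - (invmx B *m g) in
  let rho := - dotv g d in
  let s := t *: d in
  posdef W -> posdef B -> g != 0 -> 0 < t -> 0 < dotv y s ->
  dotv y (W *m y) <= Lam * dotv y s ->
  Psi (W *m bfgs_update B s y) - Psi (W *m B) <=
    Lam - 1 + ln (t ^+ 2 * rho ^+ 2 / (dotv g (W *m g) * dotv y s)).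
Proof.
move=> d rho s Wp Bp g0 t0 ys0 Hy.
have Bu := posdef_unit _ Bp.
have rhoE : rho = dotv g (invmx B *m g) by rewrite /rho /d dotvNr opprK.
have rho0 : 0 < rho.
  by rewrite rhoE; have [_ h] := posdef_invmx _ Bp; apply: h.
have Bs : B *m s = - t *: g.
  by rewrite /s /d -scalemxAr mulmxN (mulKVmx Bu) scalerN scaleNr.
have s0 : s != 0.
  by apply: contraTneq ys0 => ->; rewrite /dotv mulmx0 mxE ltxx.
have gWg0 : 0 < dotv g (W *m g) by have [_ h] := Wp; apply: h.
have sBs : dotv s (B *m s) = t ^+ 2 * rho.
  rewrite Bs dotvZr /s dotvZl (dotvC d g) /rho; ring.
rewrite Psi_bfgs_update // sBs Bs.
have -> : dotv (- t *: g) (W *m (- t *: g)) = - t * (- t * dotv g (W *m g)).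
  by rewrite -[W *m (_ *: _)]scalemxAr dotvZl dotvZr.
have t2 : 0 < t ^+ 2 by rewrite exprn_gt0.
have -> : - t * (- t * dotv g (W *m g)) / (t ^+ 2 * rho) = dotv g (W *m g) / rho.
  by field; rewrite !gt_eqF.
have h1 : dotv y (W *m y) / dotv y s <= Lam by rewrite ler_pdivrMr.
have q0 : 0 < dotv g (W *m g) / rho by rewrite divr_gt0.
have h2 := ln_leB1 _ _ q0.
have -> : t ^+ 2 * rho ^+ 2 / (dotv g (W *m g) * dotv y s) =
  (dotv g (W *m g) / rho)^-1 * (dotv y s / (t ^+ 2 * rho))^-1.
  by field; rewrite !gt_eqF.
have b0 : 0 < dotv y s / (t ^+ 2 * rho) by rewrite divr_gt0 // mulr_gt0.
have lnVM (a b : R) : 0 < a -> 0 < b -> ln (a^-1 * b^-1) = - ln a - ln b.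
  by move=> a0 b0'; rewrite lnM ?posrE ?invr_gt0 // !lnV ?posrE.
rewrite lnVM //.
move: h1 h2; lra.
Qed.

End BfgsUpdate.

(** * Derivatives along lines *)

Lemma normB_le_halves (R : realFieldType) (p q r e : R) :
  `|p - r| < e / 2 -> `|q - r| < e / 2 -> `|p - q| <= e.
Proof. by rewrite !ltr_norml ler_norml; lra. Qed.

Section LineDerivatives.
Context {R : realType} {n : nat}.
Implicit Types (f : 'cV[R]_n -> R) (x d u v w : 'cV[R]_n).

Lemma Ck_le (k l : nat) f : (k <= l)%N -> Ck l f -> Ck k f.
Proof.
elim: l k f => [|l IH] [|k] f //.
  by move=> _ [df _] x; exact: (differentiable_continuous (df x)).
by rewrite ltnS => kl [df Df]; split=> // d; apply: IH kl (Df d).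
Qed.

Lemma Ck_differentiable (k : nat) f x : Ck k.+1 f -> differentiable f x.
Proof. by case=> df _; exact: df. Qed.

Lemma Ck_derive (k : nat) f d : Ck k.+1 f -> Ck k ('D_d f).
Proof. by case=> _ Df; exact: Df. Qed.

Lemma is_derive_line f x d (t : R) : differentiable f (x + t *: d) ->
  is_derive t 1 (fun t => f (x + t *: d)) ('D_d f (x + t *: d)).
Proof.
move=> df0; have df : derivable f (x + t *: d) d by apply: diff_derivable.
have E : (fun h : R => h^-1 *: (((fun t => f (x + t *: d)) \o shift t) (h *: 1) - f (x + t *: d)))
    = (fun h : R => h^-1 *: ((f \o shift (x + t *: d)) (h *: d) - f (x + t *: d))).
  apply/funext => h /=; congr (_ *: (f _ - _)).
  by rewrite [h *: 1]mulr1 scalerDl addrCA.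
split; first by rewrite /derivable E.
by rewrite /derive E.
Qed.

Lemma colE d : d = \sum_i d i 0 *: basisv i.
Proof.
apply/colP => i; rewrite summxE (bigD1 i) //= !mxE !eqxx mulr1 big1 ?addr0 // => j ji.
by rewrite !mxE eq_sym (negbTE ji) mulr0.
Qed.

Lemma derive_basis f x d : differentiable f x ->
  'D_d f x = \sum_i d i 0 * 'D_(basisv i) f x.
Proof.
move=> df; rewrite deriveE // [in LHS](colE d) linear_sum.
by apply: eq_bigr => i _; rewrite linearZ /= deriveE.
Qed.

Lemma derive_grad f x d : differentiable f x -> 'D_d f x = dotv (grad f x) d.
Proof.
by move=> df; rewrite derive_basis // dotvE; apply: eq_bigr => i _; rewrite mxE mulrC.
Qed.

Lemma derive_lincomb (c : 'I_n -> R) (F : 'I_n -> 'cV[R]_n -> R) x d :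
  (forall i, differentiable (F i) x) ->
  'D_d (fun z => \sum_i c i * F i z) x = \sum_i c i * 'D_d (F i) x.
Proof.
move=> dF.
have -> : (fun z => \sum_i c i * F i z) = \sum_i (c i *: F i).
  by apply/funext => z; rewrite fct_sumE.
rewrite derive_sum => [|i]; last by apply: derivableZ; apply: diff_derivable.
by apply: eq_bigr => i _; rewrite deriveZ //; apply: diff_derivable.
Qed.

Lemma derive_basis_fun f d : Ck 1 f ->
  'D_d f = (fun z => \sum_i d i 0 * 'D_(basisv i) f z).
Proof. by move=> fC; apply/funext => z; rewrite derive_basis //; apply: Ck_differentiable fC. Qed.

Lemma derive2_basis f x u w : Ck 2 f ->
  'D_u ('D_w f) x = \sum_i \sum_j u i 0 * w j 0 * 'D_(basisv i) ('D_(basisv j) f) x.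
Proof.
move=> fC; rewrite derive_basis; last exact: Ck_differentiable (Ck_derive _ _ _ fC).
apply: eq_bigr => i _; rewrite (derive_basis_fun f w); last exact: (Ck_le 1 2 _ _ fC).
rewrite derive_lincomb; last by move=> j; exact: Ck_differentiable (Ck_derive _ _ _ fC).
by rewrite mulr_sumr; apply: eq_bigr => j _; rewrite mulrA.
Qed.

Lemma derive2_hess f x u w : Ck 2 f -> 'D_u ('D_w f) x = dotv u (hess f x *m w).
Proof.
move=> fC; rewrite derive2_basis // dotvE; apply: eq_bigr => i _.
rewrite mxE mulr_sumr; apply: eq_bigr => j _; rewrite mxE; ring.
Qed.

Lemma derive3_deriv3 f x d : Ck 3 f -> 'D_d ('D_d ('D_d f)) x = deriv3 f x d.
Proof.
move=> fC; rewrite derive2_basis; last exact: Ck_derive.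
apply: eq_bigr => i _; apply: eq_bigr => j _.
have fj k : differentiable ('D_(basisv j) ('D_(basisv k) f)) x.
  exact: Ck_differentiable (Ck_derive _ _ _ (Ck_derive _ _ _ fC)).
rewrite (derive_basis_fun f d); last exact: (Ck_le 1 3 _ _ fC).
have -> : 'D_(basisv j) (fun z => \sum_k d k 0 * 'D_(basisv k) f z) =
   (fun z => \sum_k d k 0 * 'D_(basisv j) ('D_(basisv k) f) z).
  apply/funext => z; rewrite derive_lincomb // => k.
  exact: Ck_differentiable (Ck_derive _ _ _ fC).
rewrite derive_lincomb // mulr_sumr; apply: eq_bigr => k _; ring.
Qed.

(** The mean value theorem is used in direction [u], then in direction [v]. Exchanging [u] and [v]
    gives the symmetry of second derivatives; [u = v] links convexity to the Hessian. *)
Lemma double_difference f x u v (h : R) : Ck 2 f -> 0 < h ->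
  exists a b, [/\ 0 <= a <= h, 0 <= b <= h &
   f (x + h *: u + h *: v) - f (x + h *: u) - (f (x + h *: v) - f x)
     = h ^+ 2 * 'D_v ('D_u f) (x + a *: u + b *: v)].
Proof.
move=> fC h0.
have df z : differentiable f z by exact: Ck_differentiable fC.
have dDf z : differentiable ('D_u f) z by exact: Ck_differentiable (Ck_derive _ _ _ fC).
pose p t := f (x + h *: v + t *: u) - f (x + t *: u).
pose dp t := 'D_u f (x + h *: v + t *: u) - 'D_u f (x + t *: u).
have dpP (t : R) : is_derive t 1 p (dp t).
  by apply: is_deriveB; apply: is_derive_line.
have cp : {within `[0, h], continuous p}.
  by apply: derivable_within_continuous => t _; have [] := dpP t.
have [a ah Ha] := @MVT_segment R p dp 0 h (ltW h0) (fun t _ => dpP t) cp.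
pose q t := 'D_u f (x + a *: u + t *: v).
pose dq t := 'D_v ('D_u f) (x + a *: u + t *: v).
have dqP (t : R) : is_derive t 1 q (dq t) by apply: is_derive_line.
have cq : {within `[0, h], continuous q}.
  by apply: derivable_within_continuous => t _; have [] := dqP t.
have [b bh Hb] := @MVT_segment R q dq 0 h (ltW h0) (fun t _ => dqP t) cq.
exists a, b; split; [by move: ah; rewrite in_itv | by move: bh; rewrite in_itv |].
move: Ha Hb; rewrite /p /dp /q /dq !scale0r !addr0 subr0 => Ha Hb.
rewrite [x + h *: u + h *: v]addrAC.
have -> : f (x + h *: v + h *: u) - f (x + h *: u) - (f (x + h *: v) - f x) =
  ('D_u f (x + h *: v + a *: u) - 'D_u f (x + a *: u)) * h by rewrite -Ha.
by rewrite [x + h *: v + a *: u]addrAC Hb expr2; ring.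
Qed.

Lemma continuous_near_segments (G : 'cV[R]_n -> R) x u v (e : R) :
  continuous G -> 0 < e -> exists2 h, 0 < h &
   forall a b, 0 <= a <= h -> 0 <= b <= h -> `|G x - G (x + a *: u + b *: v)| < e.
Proof.
move=> /(_ x) /cvgrPdist_lt /(_ e) /[apply] /nbhs_ballP [r /= r0 rP].
(* The summand 1 keeps [N] positive even when both directions vanish. *)
pose N := `|u| + `|v| + 1.
have N0 : 0 < N by rewrite ltr_wpDl // addr_ge0.
exists (r / (2 * N)); first by rewrite divr_gt0 // mulr_gt0.
move=> a b /andP[a0 ah] /andP[b0 bh]; apply: rP.
rewrite -ball_normE /= -addrA opprD addrA subrr sub0r normrN.
apply: le_lt_trans (ler_normD _ _) _; rewrite !normrZ !ger0_norm //.
have : a * `|u| + b * `|v| <= r / (2 * N) * N.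
  rewrite /N [_ * (_ + 1)]mulrDr mulr1 mulrDr.
  rewrite -[leLHS]addr0 lerD //; last by rewrite divr_ge0 ?mulr_ge0 // ltW.
  by apply: lerD; apply: ler_wpM2r.
move=> /le_lt_trans; apply.
have -> : r / (2 * N) * N = r / 2 by field; rewrite gt_eqF.
by rewrite ltr_pdivrMr // ltr_pMr // ltr1n.
Qed.

(** The double difference is symmetric in [u] and [v], so the two mixed derivatives agree at two
    points close to [x]; continuity brings both points back to [x]. *)
Lemma derive_comm f x u v : Ck 2 f -> 'D_u ('D_v f) x = 'D_v ('D_u f) x.
Proof.
move=> fC; apply/eqP; rewrite -subr_eq0 -normr_le0; apply/ler_addgt0Pl => e e0.
have cuv : continuous ('D_u ('D_v f)) := Ck_derive _ _ _ (Ck_derive _ _ _ fC).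
have cvu : continuous ('D_v ('D_u f)) := Ck_derive _ _ _ (Ck_derive _ _ _ fC).
have e2 : 0 < e / 2 by rewrite divr_gt0.
have [h1 h10 H1] := continuous_near_segments _ x v u _ cuv e2.
have [h2 h20 H2] := continuous_near_segments _ x u v _ cvu e2.
pose h := Num.min h1 h2.
have h0 : 0 < h by rewrite lt_min h10 h20.
have hh1 a : 0 <= a <= h -> 0 <= a <= h1.
  by move=> /andP[-> /le_trans]; apply; rewrite ge_min lexx.
have hh2 a : 0 <= a <= h -> 0 <= a <= h2.
  by move=> /andP[-> /le_trans]; apply; rewrite ge_min lexx orbT.
have [a [b [ah bh D1]]] := double_difference f x v u h fC h0.
have [a' [b' [ah' bh' D2]]] := double_difference f x u v h fC h0.
have E : 'D_u ('D_v f) (x + a *: v + b *: u) = 'D_v ('D_u f) (x + a' *: u + b' *: v).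
  apply: (mulfI (lt0r_neq0 (exprn_gt0 2 h0))).
  have swap (p q r s : R) : p - q - (r - s) = p - r - (q - s) by ring.
  by rewrite -[LHS]D1 -[RHS]D2 [x + h *: v + h *: u]addrAC; exact: swap.
rewrite addr0; apply: normB_le_halves (H2 _ _ (hh2 _ ah') (hh2 _ bh')).
by rewrite -E; exact: H1 (hh1 _ ah) (hh1 _ bh).
Qed.

Lemma hess_sym f x : Ck 2 f -> (hess f x)^T = hess f x.
Proof. by move=> fC; apply/matrixP => i j; rewrite !mxE derive_comm. Qed.

End LineDerivatives.

(** * Consequences of the Hessian bounds *)

Lemma is_derive_lin_comb (R : realType) (A B : R -> R) (a b c L t : R) :
  is_derive t 1 A a -> is_derive t 1 B b ->
  is_derive t 1 (fun t => c * t - (2 * A t - L * B t)) (c - (2 * a - L * b)).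
Proof.
move=> dA dB; apply: is_deriveB; first by apply: is_derive_eq; rewrite /GRing.scale /=; ring.
Qed.

Section HessianBounds.
Context {R : realType} {n : nat}.
Implicit Types (f : 'cV[R]_n -> R) (x y d u v w z : 'cV[R]_n).

Lemma le_of_near (G : 'cV[R]_n -> R) x v (c : R) : continuous G ->
  (forall h, 0 < h -> exists a b,
     [/\ 0 <= a <= h, 0 <= b <= h & c <= G (x + a *: v + b *: v)]) ->
  c <= G x.
Proof.
move=> cG H; apply/ler_addgt0Pr => e e0.
have [h h0 near_x] := continuous_near_segments G x v v e cG e0.
have [a [b [ah bh ch]]] := H h h0.
apply: le_trans ch _; rewrite -lerBlDl.
by apply: le_trans (ltW (near_x a b ah bh)); rewrite distrC ler_norm.
Qed.

Lemma ge_of_near (G : 'cV[R]_n -> R) x v (c : R) : continuous G ->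
  (forall h, 0 < h -> exists2 a, 0 <= a <= h & G (x + a *: v) <= c) ->
  G x <= c.
Proof.
move=> cG H; apply/ler_addgt0Pr => e e0.
have [h h0 near_x] := continuous_near_segments G x v v e cG e0.
have [a ah ch] := H h h0.
rewrite -lerBlDl; apply: le_trans (_ : G x - G (x + a *: v) <= _).
  by rewrite lerD2l lerN2.
have := near_x a 0 ah; rewrite lexx ltW // scale0r addr0 => /(_ erefl) /ltW.
by apply: le_trans; exact: ler_norm.
Qed.

Lemma strongly_convex_hess (mu : R) f x v : Ck 3 f -> strongly_convex mu f ->
  mu * dotv v v <= dotv v (hess f x *m v).
Proof.
move=> fC sc; have f2 := Ck_le 2 3 f erefl fC.
have cG : continuous ('D_v ('D_v f)) :=
  Ck_le 0 1 _ erefl (Ck_derive _ _ _ (Ck_derive _ _ _ fC)).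
rewrite -derive2_hess //; apply: (le_of_near _ x v _ cG).
move=> h h0; have [a [b [ah bh E]]] := double_difference f x v v h f2 h0.
exists a, b; split=> //.
rewrite -(ler_pM2l (exprn_gt0 2 h0)) -E.
have half01 : 0 <= (2^-1 : R) <= 1 by clear; lra.
(* Strong convexity at the midpoint [x + h v] of [x] and [x + 2 h v] bounds the second difference
   from below by [h^2 mu (v . v)]. *)
have := sc (x + h *: v + h *: v) x 2^-1 half01.
have -> : 2^-1 *: (x + h *: v + h *: v) + (1 - 2^-1) *: x = x + h *: v.
  apply/colP => i; rewrite !mxE; by field.
have -> : x + h *: v + h *: v - x = (2 * h) *: v.
  apply/colP => i; rewrite !mxE; ring.
rewrite sqr_enorm dotvZl dotvZr.
move: (dotv v v) (f (x + h *: v)) (f (x + h *: v + h *: v)) (f x) => V F1 F2 F0.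
have -> : 2^-1 * (1 - 2^-1) * mu / 2 * (2 * h * (2 * h * V)) = 2^-1 * (h ^+ 2 * (mu * V)) by field.
move: (h ^+ 2 * (mu * V)) => X; clear; lra.
Qed.

Lemma lipschitz_grad_hess (L : R) f x v : Ck 3 f -> 0 < L -> lipschitz_grad L f ->
  dotv v (hess f x *m v) <= L * dotv v v.
Proof.
move=> fC L0 lip; have f2 := Ck_le 2 3 f erefl fC.
have df z : differentiable f z by exact: Ck_differentiable fC.
have dDf z : differentiable ('D_v f) z by exact: Ck_differentiable (Ck_derive _ _ _ fC).
have cG : continuous ('D_v ('D_v f)) :=
  Ck_le 0 1 _ erefl (Ck_derive _ _ _ (Ck_derive _ _ _ fC)).
rewrite -derive2_hess //; apply: (ge_of_near _ x v _ cG).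
move=> h h0.
pose p t := 'D_v f (x + t *: v).
pose dp t := 'D_v ('D_v f) (x + t *: v).
have dpP (t : R) : is_derive t 1 p (dp t) by apply: is_derive_line.
have cp : {within `[0, h], continuous p}.
  by apply: derivable_within_continuous => t _; have [] := dpP t.
have [a ah E] := @MVT_segment R p dp 0 h (ltW h0) (fun t _ => dpP t) cp.
exists a => //; rewrite -(ler_pM2r h0) -/(dp a).
move: E; rewrite subr0 => <-; rewrite /p scale0r addr0 !derive_grad // -dotvBl.
apply: le_trans (dotv_cauchy _ _) _.
apply: le_trans (ler_wpM2r (enorm_ge0 _) (lip _ _)) _.
rewrite [x + _ - x]addrC addKr enormZ (gtr0_norm h0) -sqr_enorm.
by rewrite le_eqVlt; apply/orP; left; apply/eqP; ring.
Qed.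

Lemma posdef_hess (mu : R) f x : Ck 3 f -> 0 < mu -> strongly_convex mu f ->
  posdef (hess f x).
Proof.
move=> fC mu0 sc; split; first exact: hess_sym (Ck_le 2 3 f erefl fC).
move=> v v0; apply: lt_le_trans (strongly_convex_hess mu f x v fC sc).
by rewrite mulr_gt0 // dotvv_gt0.
Qed.

(** Ensures that the set in [spectral_norm] is bounded, so that its [sup] is an upper bound. The
    constant is the Frobenius norm. *)
Lemma enorm_mulmx_bounded (A : 'M[R]_n) :
  exists K, forall v, enorm v <= 1 -> enorm (A *m v) <= K.
Proof.
exists (Num.sqrt (\sum_i dotv (row i A)^T (row i A)^T)) => v v1.
rewrite /enorm ler_sqrt; last by rewrite sumr_ge0 // => i _; rewrite dotvv_ge0.
rewrite dotvE; apply: ler_sum => i _.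
have E : (A *m v) i 0 = dotv (row i A)^T v.
  by rewrite /dotv trmxK -row_mul [RHS]mxE.
rewrite E -expr2; apply: le_trans (_ : (enorm (row i A)^T * enorm v) ^+ 2 <= _).
  rewrite -[leLHS]real_normK ?num_real // lerXn2r ?nnegrE ?mulr_ge0 ?enorm_ge0 //.
  rewrite ler_norml dotv_cauchy andbT lerNl -dotvNl.
  have -> : enorm (row i A)^T = enorm (- (row i A)^T) by rewrite /enorm dotvNl dotvNr opprK.
  exact: dotv_cauchy.
rewrite exprMn !sqr_enorm ler_piMr ?dotvv_ge0 // -sqr_enorm.
by rewrite expr_le1 // enorm_ge0.
Qed.

Lemma quad_le_spectral_norm (A : 'M[R]_n) v :
  dotv v (A *m v) <= spectral_norm A * dotv v v.
Proof.
have [->|v0] := eqVneq v 0.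
  by rewrite mulmx0 /dotv trmx0 mul0mx mxE mulr0.
have N0 : 0 < enorm v by rewrite sqrtr_gt0 dotvv_gt0.
have [K KP] := enorm_mulmx_bounded A.
have Hs : enorm (A *m ((enorm v)^-1 *: v)) <= spectral_norm A.
  apply: ub_le_sup.
    by exists K => _ [w /= w1 <-]; apply: KP.
  exists ((enorm v)^-1 *: v) => //=.
  by rewrite enormZ ger0_norm ?invr_ge0 ?enorm_ge0 // mulVf // gt_eqF.
apply: le_trans (dotv_cauchy _ _) _.
rewrite -scalemxAr enormZ ger0_norm ?invr_ge0 ?enorm_ge0 // in Hs.
rewrite mulrC -sqr_enorm expr2 mulrA ler_wpM2r ?enorm_ge0 //.
by rewrite -ler_pdivrMr // mulrC.
Qed.

Lemma lipschitz_hess_quad (L2 : R) f x y v : lipschitz_hess L2 f ->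
  dotv v (hess f x *m v) <= dotv v (hess f y *m v) + L2 * enorm (x - y) * dotv v v.
Proof.
move=> lip; rewrite -lerBlDl -dotvBr -mulmxBl.
apply: le_trans (quad_le_spectral_norm _ _) _.
by rewrite ler_wpM2r ?dotvv_ge0.
Qed.

Lemma gap_lower_quadratic (mu : R) f xs x : strongly_convex mu f ->
  (forall z, f xs <= f z) -> mu / 2 * dotv (x - xs) (x - xs) <= f x - f xs.
Proof.
move=> sc fmin; rewrite -sqr_enorm; set B := _ * _.
have H l : 0 < l < 1 -> (1 - l) * B <= f x - f xs.
  move=> /andP[l0 l1]; have l01 : 0 <= l <= 1 by rewrite !ltW.
  rewrite -(ler_pM2l l0) /B; have := le_trans (fmin _) (sc x xs l l01).
  move: (enorm _ ^+ 2) (f x) (f xs) => V F F'.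
  have -> : l * ((1 - l) * (mu / 2 * V)) = l * (1 - l) * mu / 2 * V by field.
  by move: (l * (1 - l) * mu / 2 * V) => X; clear; lra.
rewrite leNgt; apply/negP => AB.
set A := f x - f xs in H AB.
have B0 : 0 < B.
  have h01 : 0 < (2^-1 : R) < 1 by clear; lra.
  by have := H _ h01; move: AB; clear; lra.
have A0 : 0 <= A by rewrite subr_ge0.
clearbody A B.
(* The bound is the limit of [H] as [l] tends to 0. If [A < B], this [l] already turns [H] into
   [(A + B) / 2 <= A], a contradiction. *)
have := H ((B - A) / (2 * B)).
have -> : (1 - (B - A) / (2 * B)) * B = (A + B) / 2 by field; rewrite gt_eqF.
have l0 : 0 < (B - A) / (2 * B) by rewrite divr_gt0 ?subr_gt0 ?mulr_gt0.
have l1 : (B - A) / (2 * B) < 1.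
  by rewrite ltr_pdivrMr ?mulr_gt0 // mul1r; move: A0 B0; clear; lra.
by rewrite l0 l1 => /(_ erefl); move: AB; clear; lra.
Qed.

Lemma strongly_convex_segment (mu : R) f x y (l : R) : 0 <= mu -> strongly_convex mu f ->
  0 <= l <= 1 -> f (l *: x + (1 - l) *: y) <= l * f x + (1 - l) * f y.
Proof.
move=> mu0 sc /[dup] /andP[l0 l1] l01; apply: le_trans (sc x y l l01) _.
by rewrite gerBl !(sqr_ge0, subr_ge0, invr_ge0, ler0n, mulr_ge0).
Qed.

Lemma taylor_lower f x v (c : R) : Ck 3 f ->
  (forall t : R, 0 <= t <= 1 -> c <= dotv v (hess f (x + t *: v) *m v)) ->
  f x + dotv (grad f x) v + c / 2 <= f (x + v).
Proof.
move=> fC cH; have f2 := Ck_le 2 3 f erefl fC.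
have df z : differentiable f z by exact: Ck_differentiable fC.
have dDf z : differentiable ('D_v f) z by exact: Ck_differentiable (Ck_derive _ _ _ fC).
have grad_growth (t : R) : 0 <= t <= 1 -> 'D_v f x + c * t <= 'D_v f (x + t *: v).
  move=> /andP[t0 t1].
  have := @le_is_derive_ge0 R (fun t => 'D_v f (x + t *: v) - c * t)
    (fun t => 'D_v ('D_v f) (x + t *: v) - c) 0 t t0.
  rewrite scale0r addr0 mulr0 subr0 lerBrDr; apply => s /andP[s0 st].
  - apply: is_deriveB; first exact: is_derive_line.
    by apply: is_derive_eq; rewrite /GRing.scale /=; ring.
  - by rewrite subr_ge0 derive2_hess // cH // s0 (le_trans st).
have := @le_is_derive_ge0 R (fun t => f (x + t *: v) - ('D_v f x * t + c / 2 * t ^+ 2))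
  (fun t => 'D_v f (x + t *: v) - ('D_v f x + c * t)) 0 1 ler01.
rewrite scale0r scale1r addr0 expr1n expr0n !mulr0 addr0 subr0 !mulr1 -derive_grad // -addrA -lerBrDr.
apply => t t01.
- apply: is_deriveB; first exact: is_derive_line.
  by apply: is_derive_eq; rewrite /GRing.scale /=; field.
- by rewrite subr_ge0 grad_growth.
Qed.

(* Apply the mean value theorem on the segment to [2 w . grad f - Lam s . grad f]
   with [w = W y], whose derivative is at most [w . H w / Lam] by Cauchy-Schwarz. *)
Lemma weighted_cocoercive (W P : 'M[R]_n) (Lam : R) f x s :
  Ck 3 f -> 0 < Lam -> P *m W = 1%:M ->
  (forall z w, 0 <= dotv w (hess f z *m w)) ->
  (forall (t : R) w, 0 <= t <= 1 ->
     dotv w (hess f (x + t *: s) *m w) <= Lam * dotv w (P *m w)) ->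
  dotv (grad f (x + s) - grad f x) (W *m (grad f (x + s) - grad f x)) <=
    Lam * dotv (grad f (x + s) - grad f x) s.
Proof.
move=> fC Lam0 PW psd HP; set y := grad f (x + s) - grad f x; have f2 := Ck_le 2 3 f erefl fC.
have df z : differentiable f z by exact: Ck_differentiable fC.
have dDf u z : differentiable ('D_u f) z by exact: Ck_differentiable (Ck_derive _ _ _ fC).
pose w := W *m y.
have := @le_is_derive_ge0 R
  (fun t => dotv y w * t - (2 * 'D_w f (x + t *: s) - Lam * 'D_s f (x + t *: s)))
  (fun t => dotv y w - (2 * 'D_s ('D_w f) (x + t *: s) - Lam * 'D_s ('D_s f) (x + t *: s))) 0 1 ler01.
rewrite scale0r scale1r addr0 mulr0 mulr1 sub0r !derive_grad // => H.
have {}H : - (2 * dotv (grad f x) w - Lam * dotv (grad f x) s) <=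
  dotv y w - (2 * dotv (grad f (x + s)) w - Lam * dotv (grad f (x + s)) s).
  apply: H => t t01.
  - by apply: is_derive_lin_comb; exact: is_derive_line.
  - rewrite !derive2_hess // subr_ge0.
    have Lam'0 : 0 < Lam^-1 by rewrite invr_gt0.
    have := @psd_cross R n _ _ w s (hess_sym f (x + t *: s) f2) (psd _) Lam'0.
    rewrite dotv_mulmxr hess_sym // dotvC invrK -lerBlDr => /le_trans; apply.
    rewrite mulrC ler_pdivrMr // mulrC; apply: le_trans (HP t w t01) _.
    by rewrite /w mulmxA PW mul1mx dotvC.
move: H; rewrite -/w /y !dotvBl.
move: (dotv (grad f x) w) (dotv (grad f x) s) (dotv (grad f (x + s)) w) (dotv (grad f (x + s)) s).
clear => a b c e; rewrite mulrBr; lra.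
Qed.

(** A Polyak-Lojasiewicz inequality in the metric of [W]: in the Taylor lower bound from [x] to
    [xs], Young's inequality with weight [K] absorbs the linear term into the quadratic one and
    leaves the dual norm of the gradient. *)
Lemma gap_le_dual_norm (W P : 'M[R]_n) (K : R) f xs x :
  Ck 3 f -> 0 < K -> P *m W = 1%:M -> P^T = P ->
  (forall w, 0 <= dotv w (P *m w)) ->
  (forall t : R, 0 <= t <= 1 ->
     dotv (xs - x) (P *m (xs - x)) <=
       K * dotv (xs - x) (hess f (x + t *: (xs - x)) *m (xs - x))) ->
  f x - f xs <= K / 2 * dotv (grad f x) (W *m grad f x).
Proof.
move=> fC K0 PW Ps Pp H; set v := xs - x; set g := grad f x.
have := @taylor_lower f x v (K^-1 * dotv v (P *m v)) fC.
have -> : x + v = xs by rewrite addrC subrK.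
have e1 : dotv (W *m g) (P *m v) = dotv g v.
  by rewrite dotv_mulmxr Ps mulmxA PW mul1mx.
have e2 : dotv (W *m g) (P *m (W *m g)) = dotv g (W *m g).
  by rewrite (mulmxA P) PW mul1mx dotvC.
have := @psd_cross R n P K (- (W *m g)) v Ps Pp K0.
rewrite mulmxN !dotvNl dotvNr opprK e1 e2 => E /(_ _) T.
have {}T : f x + dotv g v + K^-1 * dotv v (P *m v) / 2 <= f xs.
  by apply: T => t t01; rewrite mulrC ler_pdivrMr // mulrC H.
move: E T; have -> : K / 2 * dotv g (W *m g) = K * dotv g (W *m g) / 2 by ring.
move: (dotv g v) (K * dotv g (W *m g)) (K^-1 * _) (f x) (f xs) => a b c F F'.
by clear; lra.
Qed.

End HessianBounds.

(** * Adaptive BFGS iterations *)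

(** Combines [1 + 2 e <= (1 + e)^2] with [omega_lower_ln]. *)
Lemma ln1D_double_le_sqrt (R : realType) (e m F : R) : 0 <= e -> 0 <= m -> 0 <= F ->
  omega e <= m ^+ 2 * F -> ln (1 + 2 * e) <= 2 * Num.sqrt 2 * m * Num.sqrt F.
Proof.
move=> e0 m0 F0 H; have e1 : 0 < 1 + e by rewrite ltr_wpDr.
apply: le_trans (_ : 2 * ln (1 + e) <= _).
  have -> : 2 * ln (1 + e) = ln ((1 + e) ^+ 2) by rewrite expr2 lnM ?posrE //; ring.
  rewrite ler_ln ?posrE ?exprn_gt0 ?ltr_wpDr ?mulr_ge0 //.
  rewrite -subr_ge0; have -> : (1 + e) ^+ 2 - (1 + 2 * e) = e ^+ 2 by ring.
  exact: sqr_ge0.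
have u0 : 0 <= ln (1 + e) by rewrite ln_ge0 // lerDl.
rewrite -(@ler_pXn2r _ 2) ?nnegrE ?mulr_ge0 ?sqrtr_ge0 //.
rewrite !exprMn !sqr_sqrtr //.
have := le_trans (omega_lower_ln _ _ e0) H.
have -> : 2 ^+ 2 * 2 * m ^+ 2 * F = 8 * (m ^+ 2 * F) by ring.
have -> : (2 : R) ^+ 2 = 4 by ring.
by move: (m ^+ 2 * F) (ln _ ^+ 2) => X Y; clear; lra.
Qed.

Section Iteration.
Context {R : realType} {n : nat}.
Variables (mu L M L2 : R) (f : 'cV[R]_n -> R) (xs : 'cV[R]_n).
Hypotheses (mu0 : 0 < mu) (L0 : 0 < L) (M0 : 0 < M) (L20 : 0 < L2).
Hypotheses (fC : Ck 3 f) (sc : strongly_convex mu f) (lip : lipschitz_grad L f).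
Hypothesis selfc : forall x d, `|deriv3 f x d| <= 2 * M * local_norm f x d ^+ 3.
Hypothesis liph : lipschitz_hess L2 f.
Hypothesis fmin : forall x, f xs <= f x.

Let f2 : Ck 2 f := Ck_le 2 3 f erefl fC.

Section Step.
Variables (x : 'cV[R]_n) (B : 'M[R]_n).
Hypotheses (Bp : posdef B) (g0 : grad f x != 0).

Let g := grad f x.
Let d := bfgs_dir f x B.
Let rho : R := - dotv g d.
Let eta : R := M * rho / local_norm f x d.
Let t := adaptive_step f M x d.
Let s := t *: d.
Let y := grad f (x + s) - g.

Lemma adaptive_bfgs_step :
  [/\ 0 < t, 0 < rho, 0 <= eta & 0 < dotv y s] /\
  [/\ 0 < f x - f (x + s),
    omega eta <= M ^+ 2 * (f x - f (x + s)) &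
    t ^+ 2 * rho ^+ 2 <= 2 * (1 + 2 * eta) * dotv y s * (f x - f (x + s))].
Proof.
have rhoE : rho = dotv g (invmx B *m g) by rewrite /rho /d /bfgs_dir dotvNr opprK.
have rho0 : 0 < rho by rewrite rhoE; have [_ h] := posdef_invmx _ Bp; apply: h.
have d0 : d != 0.
  by apply: contraTneq rho0 => dE; rewrite /rho dE /dotv mulmx0 mxE oppr0 ltxx.
have Hp z : 0 < dotv d (hess f z *m d).
  by have [_ h] := posdef_hess _ _ z fC mu0 sc; apply: h.
have df z : differentiable f z by exact: Ck_differentiable fC.
have dDf z : differentiable ('D_d f) z by exact: Ck_differentiable (Ck_derive _ _ _ fC).
have dDDf z : differentiable ('D_d ('D_d f)) z.
  exact: Ck_differentiable (Ck_derive _ _ _ (Ck_derive _ _ _ fC)).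
pose p (u : R) := f (x + u *: d).
pose p1 (u : R) := 'D_d f (x + u *: d).
pose p2 (u : R) := 'D_d ('D_d f) (x + u *: d).
pose p3 (u : R) := 'D_d ('D_d ('D_d f)) (x + u *: d).
have dp (u : R) : is_derive u 1 p (p1 u) by apply: is_derive_line.
have dp1 (u : R) : is_derive u 1 p1 (p2 u) by apply: is_derive_line.
have dp2 (u : R) : is_derive u 1 p2 (p3 u) by apply: is_derive_line.
have p2E u : p2 u = dotv d (hess f (x + u *: d) *m d) by rewrite /p2 derive2_hess.
have p2_gt0 u : 0 < p2 u by rewrite p2E.
have p3_le u : `|p3 u| <= 2 * M * Num.sqrt (p2 u) ^+ 3.
  by rewrite /p3 derive3_deriv3 // p2E; exact: selfc.
have p10 : p1 0 = - rho by rewrite /p1 scale0r addr0 derive_grad // opprK.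
have p0 : p 0 = f x by rewrite /p scale0r addr0.
have lnE : Num.sqrt (p2 0) = local_norm f x d by rewrite p2E scale0r addr0.
have tE : rho / (Num.sqrt (p2 0) * (Num.sqrt (p2 0) + M * rho)) = t.
  by rewrite lnE /t /adaptive_step -/g /rho mulrN mulNr.
have ld : 0 < local_norm f x d by rewrite -lnE sqrtr_gt0.
have t0 : 0 < t by rewrite -tE lnE divr_gt0 // mulr_gt0 // addr_gt0 // mulr_gt0.
have eta0 : 0 <= eta by rewrite /eta divr_ge0 ?mulr_ge0 // ltW.
have := @adaptive_step_line_product R p p1 p2 p3 M rho M0 rho0 dp dp1 dp2 p2_gt0 p3_le p10.
have := @adaptive_step_line_decrease R p p1 p2 p3 M rho M0 rho0 dp dp1 dp2 p2_gt0 p3_le p10.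
rewrite tE lnE p0 -/eta.
have -> : p t = f (x + s) by [].
have -> : t * (p1 t - p1 0) = dotv y s.
  by rewrite /p1 scale0r addr0 !derive_grad // -dotvBl /s dotvZr.
move=> H1 H2.
have {}H1 : omega eta <= M ^+ 2 * (f x - f (x + s)).
  by rewrite mulrC -ler_pdivrMr // exprn_gt0.
have D0 : 0 <= f x - f (x + s).
  have := le_trans (omega_ge0 _ _ eta0) H1.
  by rewrite pmulr_rge0 // exprn_gt0.
(* The left side of the product inequality is positive, which makes the decrease, so far only
   nonnegative, strictly positive, and then [y . s] as well. *)
have pos : 0 < 2 * (1 + 2 * eta) * dotv y s * (f x - f (x + s)).
  by apply: lt_le_trans H2; rewrite mulr_gt0 // exprn_gt0.
have e1 : 0 < 2 * (1 + 2 * eta) by rewrite mulr_gt0 // ltr_wpDr // mulr_ge0.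
have Dn : f x - f (x + s) != 0 by apply: contraTneq pos => ->; rewrite mulr0 ltxx.
have D0' : 0 < f x - f (x + s) by rewrite lt_def Dn D0.
split; split=> //.
by move: pos; rewrite pmulr_lgt0 // pmulr_rgt0.
Qed.

Let p W := t ^+ 2 * rho ^+ 2 / (dotv g (W *m g) * dotv y s).

Lemma weighted_bfgs_step (W P : 'M[R]_n) (Lam K : R) :
  posdef W -> posdef P -> P *m W = 1%:M -> 0 < Lam -> 0 < K ->
  (forall (u : R) w, 0 <= u <= 1 ->
     dotv w (hess f (x + u *: s) *m w) <= Lam * dotv w (P *m w)) ->
  (forall (u : R) w, 0 <= u <= 1 ->
     dotv w (P *m w) <= K * dotv w (hess f (x + u *: (xs - x)) *m w)) ->
  [/\ 0 < p W,
   Psi (W *m bfgs_update B s y) - Psi (W *m B) <= Lam - 1 + ln (p W) &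
   p W * (f x - f xs) <= (f x - f (x + s)) * (K * (1 + 2 * eta))].
Proof.
move=> Wp Pp PW Lam0 K0 HLam HK.
have [[t0 rho0 eta0 ys0] [D0 _ H2]] := adaptive_bfgs_step.
have [_ Wpos] := Wp; have [Ps Ppos] := Pp.
have gWg : 0 < dotv g (W *m g) by apply: Wpos.
have Ppsd w : 0 <= dotv w (P *m w).
  have [->|w0] := eqVneq w 0; last by rewrite ltW // Ppos.
  by rewrite mulmx0 /dotv trmx0 mul0mx mxE.
have Hpsd z w : 0 <= dotv w (hess f z *m w).
  have := strongly_convex_hess mu f z w fC sc.
  by apply: le_trans; rewrite mulr_ge0 ?dotvv_ge0 // ltW.
split.
- by rewrite /p divr_gt0 // mulr_gt0 // exprn_gt0.
- apply: Psi_bfgs_step => //.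
  exact: (weighted_cocoercive W P Lam f x s).
- have gap := gap_le_dual_norm W P K f xs x fC K0 PW Ps Ppsd (fun u => HK u (xs - x)).
  rewrite /p mulrAC ler_pdivrMr ?mulr_gt0 //.
  have tr0 : 0 <= t ^+ 2 * rho ^+ 2 by rewrite mulr_ge0 ?sqr_ge0.
  apply: le_trans (ler_wpM2l tr0 gap) _.
  have c0 : 0 <= K / 2 * dotv g (W *m g) by rewrite mulr_ge0 // ?divr_ge0 // ltW.
  apply: le_trans (ler_wpM2r c0 H2) _.
  rewrite le_eqVlt; apply/orP; left; apply/eqP.
  by field.
Qed.

End Step.

(** The segment lies in the sublevel set of [x], so strong convexity bounds its distance to [xs].
    The additive error from the Lipschitz Hessian becomes relative because every Hessian dominates
    [mu]. It is used with [x'] the next iterate and with [x' = xs]. *)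
Lemma hess_near_minimizer x x' (u : R) w : f x' <= f x -> 0 <= u <= 1 ->
  let C := L2 / mu * Num.sqrt (2 / mu * (f x - f xs)) in
  let z := x + u *: (x' - x) in
  dotv w (hess f z *m w) <= (1 + C) * dotv w (hess f xs *m w) /\
  dotv w (hess f xs *m w) <= (1 + C) * dotv w (hess f z *m w).
Proof.
move=> fx' u01 C z.
have fz : f z <= f x.
  have -> : z = u *: x' + (1 - u) *: x by rewrite /z scalerBr scalerBl scale1r addrCA.
  apply: le_trans (strongly_convex_segment mu f x' x u (ltW mu0) sc u01) _.
  have /andP[u0 u1] := u01.
  have : u * f x' <= u * f x by apply: ler_wpM2l.
  by move=> h; rewrite mulrBl mul1r addrCA gerDl subr_le0.
have nz : enorm (z - xs) <= Num.sqrt (2 / mu * (f x - f xs)).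
  rewrite /enorm ler_sqrt; last by rewrite mulr_ge0 ?subr_ge0 ?divr_ge0 // ltW.
  have := gap_lower_quadratic mu f xs z sc fmin.
  rewrite -ler_pdivlMl ?divr_gt0 // invf_div => /le_trans; apply.
  by rewrite ler_wpM2l ?divr_ge0 ?lerD2r // ltW.
have bound a b : enorm (a - b) <= Num.sqrt (2 / mu * (f x - f xs)) ->
    dotv w (hess f a *m w) <= (1 + C) * dotv w (hess f b *m w).
  move=> nab; apply: le_trans (lipschitz_hess_quad L2 f a b w liph) _.
  rewrite mulrDl mul1r lerD2l.
  apply: le_trans (_ : L2 * Num.sqrt (2 / mu * (f x - f xs)) * dotv w w <= _).
    by rewrite ler_wpM2r ?dotvv_ge0 // ler_wpM2l // ltW.
  have h := strongly_convex_hess mu f b w fC sc.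
  have -> : L2 * Num.sqrt (2 / mu * (f x - f xs)) * dotv w w = C * (mu * dotv w w).
    by rewrite /C; field; rewrite gt_eqF.
  by rewrite ler_wpM2l // /C mulr_ge0 ?sqrtr_ge0 // divr_ge0 // ltW.
split; apply: bound => //.
by rewrite -opprB /enorm dotvNl dotvNr opprK.
Qed.

(** * Estimates along the sequence of iterates *)

Section Sequence.
Variables (X : nat -> 'cV[R]_n) (Bm : nat -> 'M[R]_n).

Let d k := bfgs_dir f (X k) (Bm k).
Let t k := adaptive_step f M (X k) (d k).
Let s k := t k *: d k.
Let g k := grad f (X k).
Let rho k : R := - dotv (g k) (d k).
Let eta k : R := M * rho k / local_norm f (X k) (d k).
Let F k : R := f (X k) - f xs.

Hypothesis g0 : forall k, grad f (X k) != 0.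
Hypothesis B0p : posdef (Bm 0).
Hypothesis XS : forall k, X k.+1 = X k + s k.
Hypothesis BS : forall k,
  Bm k.+1 = bfgs_update (Bm k) (s k) (grad f (X k + s k) - grad f (X k)).

Lemma bfgs_posdef k : posdef (Bm k).
Proof.
elim: k => [//|k IH]; rewrite BS.
have [[_ _ _ ys0] _] := adaptive_bfgs_step (X k) (Bm k) IH (g0 k).
apply: posdef_bfgs_update => //.
by apply: contraTneq ys0 => sE; rewrite -/(d k) -/(t k) -/(s k) sE /dotv mulmx0 mxE ltxx.
Qed.

Lemma bfgs_gap_decreasing k : 0 < F k - F k.+1.
Proof.
have [_ [D0 _ _]] := adaptive_bfgs_step (X k) (Bm k) (bfgs_posdef k) (g0 k).
by have -> : F k - F k.+1 = f (X k) - f (X k + s k) by rewrite /F XS; ring.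
Qed.

Lemma bfgs_gap_gt0 k : 0 < F k.
Proof.
by apply: lt_le_trans (bfgs_gap_decreasing k) _; rewrite gerBl subr_ge0.
Qed.

Lemma bfgs_eta_ge0 k : 0 <= eta k.
Proof. by have [[]] := adaptive_bfgs_step (X k) (Bm k) (bfgs_posdef k) (g0 k). Qed.

Lemma bfgs_omega_eta k : omega (eta k) <= M ^+ 2 * (F k - F k.+1).
Proof.
have [_ [_ H _]] := adaptive_bfgs_step (X k) (Bm k) (bfgs_posdef k) (g0 k).
by have -> : F k - F k.+1 = f (X k) - f (X k + s k) by rewrite /F XS; ring.
Qed.

(** The existential hides the formula for [p_k]: the summation arguments rely on these three
    properties alone. *)
Lemma bfgs_weighted_sequence (W P : 'M[R]_n) (Lam K : R) k :
  posdef W -> posdef P -> P *m W = 1%:M -> 0 < Lam -> 0 < K ->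
  (forall (u : R) w, 0 <= u <= 1 ->
     dotv w (hess f (X k + u *: s k) *m w) <= Lam * dotv w (P *m w)) ->
  (forall (u : R) w, 0 <= u <= 1 ->
     dotv w (P *m w) <= K * dotv w (hess f (X k + u *: (xs - X k)) *m w)) ->
  exists q, [/\ 0 < q,
   Psi (W *m Bm k.+1) - Psi (W *m Bm k) <= Lam - 1 + ln q &
   q * F k <= (F k - F k.+1) * (K * (1 + 2 * eta k))].
Proof.
move=> Wp Pp PW Lam0 K0 HLam HK.
have [q0 H1 H2] := weighted_bfgs_step (X k) (Bm k) (bfgs_posdef k) (g0 k)
  W P Lam K Wp Pp PW Lam0 K0 HLam HK.
eexists; split; [exact: q0 | by rewrite BS |].
by have -> : F k - F k.+1 = f (X k) - f (X k + s k) by rewrite /F XS; ring.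
Qed.

Lemma posdef_scalar (a : R) : 0 < a -> posdef (a%:M : 'M[R]_n).
Proof.
move=> a0; split; first exact: tr_scalar_mx.
by move=> v v0; rewrite mul_scalar_mx dotvZr mulr_gt0 // dotvv_gt0.
Qed.

Lemma bfgs_sum_sqrt_gap (l : R) (N : nat) : 3 <= l ->
  \sum_(k < N) Num.sqrt (F k / F 0) <=
    Psi (L^-1 *: Bm 0) + 2 * (L / mu) * l + 4 * (M ^+ 2 * F 0) / l.
Proof.
move=> l3.
have Li : 0 < L^-1 by rewrite invr_gt0.
have k0 : 0 < L / mu by rewrite divr_gt0.
have PW : L%:M *m (L^-1)%:M = 1%:M :> 'M[R]_n.
  by rewrite -scalar_mxM divff // gt_eqF.
have H k := bfgs_weighted_sequence (L^-1)%:M L%:M 1 (L / mu) k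
  (posdef_scalar _ Li) (posdef_scalar _ L0) PW ltr01 k0.
have {}H k : exists q, [/\ 0 < q,
   Psi ((L^-1)%:M *m Bm k.+1) - Psi ((L^-1)%:M *m Bm k) <= ln q &
   q * F k <= (F k - F k.+1) * (L / mu * (1 + 2 * eta k))].
  have [||q [q0 H1 H2]] := H k.
  - move=> u w _; rewrite mul1r mul_scalar_mx dotvZr.
    exact: lipschitz_grad_hess.
  - move=> u w _; rewrite mul_scalar_mx dotvZr -mulrA ler_wpM2l ?(ltW L0) //.
    by rewrite mulrC ler_pdivlMr // mulrC strongly_convex_hess.
  by exists q; split=> //; move: H1; rewrite subrr add0r.
have [p pP] := choice H.
have F0 := bfgs_gap_gt0 0.
(* Gaps are normalized by [F 0], so the constant [M^2] in the bound on [omega (eta k)] becomes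
   [a^2 = M^2 F 0]. *)
have sqa : Num.sqrt (M ^+ 2 * F 0) ^+ 2 = M ^+ 2 * F 0.
  by rewrite sqr_sqrtr // mulr_ge0 ?sqr_ge0 // ltW.
have := @sum_sqrt_gap R (fun k => F k / F 0) eta p
  (fun k => Psi ((L^-1)%:M *m Bm k)) (L / mu) (Num.sqrt (M ^+ 2 * F 0)) k0 _ _ _
  bfgs_eta_ge0 _ _ _ _ _ l N l3.
rewrite sqa mul_scalar_mx; apply.
- by rewrite divff // gt_eqF.
- by move=> k; rewrite divr_gt0 ?bfgs_gap_gt0.
- by move=> k; rewrite ler_pM2r ?invr_gt0 // -subr_ge0 ltW // bfgs_gap_decreasing.
- by move=> k; have [] := pP k.
- move=> k; apply: Psi_mul_ge0; [exact: posdef_scalar | exact: bfgs_posdef].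
- by move=> k; have [] := pP k.
- move=> k; have [_ _ h] := pP k.
  by rewrite -mulrBl mulrA [_ / F 0 * _]mulrAC ler_pM2r ?invr_gt0.
- move=> k; apply: le_trans (bfgs_omega_eta k) _.
  by rewrite -mulrBl mulrACA divff ?gt_eqF // mulr1.
Qed.

Lemma bfgs_gap_ratio (Mt : R) k : M <= Mt -> Mt = L2 / (2 * (mu * Num.sqrt mu)) ->
  F k.+1 / F k <= Psi (invmx (hess f xs) *m Bm k) - Psi (invmx (hess f xs) *m Bm k.+1)
     + 3 * (2 * Num.sqrt 2 * Mt * Num.sqrt (F k)).
Proof.
move=> MMt MtE.
set C := 2 * Num.sqrt 2 * Mt * Num.sqrt (F k).
have Fk := bfgs_gap_gt0 k.
have Mt0 : 0 < Mt by apply: lt_le_trans MMt.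
(* This is where [Mt = L2 / (2 mu^(3/2))] comes from: it is the constant of [hess_near_minimizer] up
   to [2 sqrt 2]. *)
have CE : L2 / mu * Num.sqrt (2 / mu * F k) = C.
  rewrite /C MtE !sqrtrM ?divr_ge0 ?ltW // sqrtrV ?ltW //.
  by field; rewrite !gt_eqF ?sqrtr_gt0.
have C0 : 0 <= C by rewrite /C !mulr_ge0 ?sqrtr_ge0 // ltW.
have C1 : 0 < 1 + C by rewrite ltr_wpDr.
have Hsp : posdef (hess f xs) := posdef_hess mu f xs fC mu0 sc.
have Hsu := posdef_unit _ Hsp.
have near (x' : 'cV[R]_n) u w : f x' <= f (X k) -> 0 <= u <= 1 -> _ :=
  @hess_near_minimizer (X k) x' u w.
have [||q [q0 H1 H2]] := bfgs_weighted_sequence (invmx (hess f xs))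
  (hess f xs) (1 + C) (1 + C) k
  (posdef_invmx _ Hsp) Hsp (mulmxV Hsu) C1 C1.
- move=> u w u01.
  have fx' : f (X k.+1) <= f (X k).
    by have := bfgs_gap_decreasing k; rewrite /F subr_gt0 ltrD2r => /ltW.
  have [+ _] := near _ u w fx' u01.
  by rewrite XS [X k + s k]addrC addrK -/(F k) CE.
- move=> u w u01; have [_ +] := near _ u w (fmin _) u01.
  by rewrite -/(F k) CE.
apply: (gap_ratio_step _ (F k) (F k.+1) q (eta k) C) => //.
- exact: bfgs_eta_ge0.
(* Thanks to [M <= Mt], the loss [ln (1 + 2 eta k)] is bounded by the same [C] as the Hessian
   comparison. *)
- apply: ln1D_double_le_sqrt; [exact: bfgs_eta_ge0 | exact: ltW | exact: ltW |].
  apply: le_trans (bfgs_omega_eta k) _.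
  apply: ler_pM; [exact: sqr_ge0 | exact: ltW (bfgs_gap_decreasing k) | |].
    by rewrite lerXn2r ?nnegrE // ltW.
  by rewrite gerBl ltW // bfgs_gap_gt0.
- by move: H1; rewrite [1 + C]addrC addrK.
Qed.

End Sequence.

End Iteration.

(** * Assembling the convergence rate *)

Lemma smoothness_ge_modulus (R : realType) (n : nat) (mu L : R)
    (f : 'cV[R]_n -> R) (v : 'cV[R]_n) :
  Ck 3 f -> 0 < L -> strongly_convex mu f -> lipschitz_grad L f -> v != 0 -> mu <= L.
Proof.
move=> fC L0 sc lip v0.
have := le_trans (strongly_convex_hess mu f 0 v fC sc)
  (lipschitz_grad_hess L f 0 v fC L0 lip).
by rewrite ler_pM2r // dotvv_gt0.
Qed.

Lemma abfgs_stepE (R : realType) (n : nat) (f : 'cV[R]_n -> R) (M : R) p :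
  let s := adaptive_step f M p.1 (bfgs_dir f p.1 p.2) *: bfgs_dir f p.1 p.2 in
  abfgs_step f M p =
    (p.1 + s, bfgs_update p.2 s (grad f (p.1 + s) - grad f p.1)).
Proof. by case: p. Qed.

(* The two branches of the minimum come from [l = 3] and [l = 3 + 2 a]. *)
Lemma sqrt_gap_budget (R : realType) (S Ps kappa a : R) :
  1 <= kappa -> 0 <= a -> 0 <= Ps ->
  (forall l, 3 <= l -> S <= Ps + 2 * kappa * l + 4 * a ^+ 2 / l) ->
  S <= 2 * Ps + 4 * Num.min ((2 * ln kappa + 1) * a ^+ 2)
                            (2 * Num.sqrt 2 * kappa * a) + 13 * kappa.
Proof.
move=> k1 a0 Ps0 H.
have k0 : 0 <= kappa by apply: le_trans k1.
have ln0 : 0 <= ln kappa by apply: ln_ge0.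
case: (leP ((2 * ln kappa + 1) * a ^+ 2)) => _.
- have := H 3 (lexx _).
  have : 0 <= ln kappa * a ^+ 2 by rewrite mulr_ge0 ?sqr_ge0.
  have := sqr_ge0 a.
  have -> : (2 * ln kappa + 1) * a ^+ 2 = 2 * (ln kappa * a ^+ 2) + a ^+ 2 by ring.
  by move: (a ^+ 2) (ln kappa * _) => b c; lra.
- have l3 : 3 <= 3 + 2 * a by rewrite lerDl mulr_ge0.
  have l0 : 0 < 3 + 2 * a by apply: lt_le_trans l3.
  have := H _ l3.
  have : 4 * a ^+ 2 / (3 + 2 * a) <= 2 * (kappa * a).
    rewrite ler_pdivrMr //.
    have : a ^+ 2 <= kappa * a ^+ 2 by rewrite ler_peMl ?sqr_ge0.
    have : 0 <= kappa * a by rewrite mulr_ge0.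
    have -> : 2 * (kappa * a) * (3 + 2 * a) = 6 * (kappa * a) + 4 * (kappa * a ^+ 2) by ring.
    by move: (kappa * a) (kappa * a ^+ 2) (a ^+ 2) => b c e; lra.
  have s2 : 1 <= Num.sqrt (2 : R) by rewrite -[leLHS]sqrtr1 ler_sqrt // ler1n.
  have : kappa * a <= Num.sqrt 2 * (kappa * a) by rewrite ler_peMl // mulr_ge0.
  have : 0 <= kappa * a by rewrite mulr_ge0.
  have -> : 2 * Num.sqrt 2 * kappa * a = 2 * (Num.sqrt 2 * (kappa * a)) by ring.
  have -> : 2 * kappa * (3 + 2 * a) = 6 * kappa + 4 * (kappa * a) by ring.
  by move: (kappa * a) (Num.sqrt 2 * _) (_ / _) => b c e; lra.
Qed.

Theorem theorem2 (R : realType) (n : nat) (mu L M L2 : R)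
    (f : 'cV[R]_n -> R) (xs x0 : 'cV[R]_n) (B0 : 'M[R]_n) :
  0 < mu -> 0 < L -> 0 < M -> 0 < L2 ->
  Ck 3 f ->
  strongly_convex mu f ->
  lipschitz_grad L f ->
  self_concordant M f ->
  lipschitz_hess L2 f ->
  let Mt := L2 / (2 * mu `^ (3 / 2)) in
  M <= Mt ->
  (forall x, f xs <= f x) ->
  posdef B0 ->
  let x := abfgs f M x0 B0 in
  (forall k, grad f (x k) != 0) ->
  let kappa := L / mu in
  let Delta := f x0 - f xs in
  let Bbar0 := L^-1 *: B0 in
  let Hs := sqrtmx (invmx (hess f xs)) in
  let Btilde0 := Hs *m B0 *m Hs in
  forall k : nat, (1 <= k)%N ->
  (f (x k) - f xs) / (f x0 - f xs) <=
    ((Psi Btilde0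
      + 8 * Num.sqrt 2 * Mt * Num.sqrt Delta
        * (2 * Psi Bbar0
           + 4 * Num.min ((2 * ln kappa + 1) * M ^+ 2 * Delta)
                         (2 * Num.sqrt 2 * kappa * M * Num.sqrt Delta)
           + 13 * kappa))
     / k%:R) ^+ k.
Proof.
move=> mu0 L0 M0 L20 fC sc lip [_ selfc] liph Mt MMt fmin B0p x g0 kappa Delta
  Bbar0 Hs Btilde0 k k1.
pose Bm j := (iter j (abfgs_step f M) (x0, B0)).2.
pose s j := adaptive_step f M (x j) (bfgs_dir f (x j) (Bm j)) *: bfgs_dir f (x j) (Bm j).
have XS j : x j.+1 = x j + s j.
  by rewrite /x /abfgs iterS abfgs_stepE.
have BS j : Bm j.+1 = bfgs_update (Bm j) (s j) (grad f (x j + s j) - grad f (x j)).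
  by rewrite {1}/Bm iterS abfgs_stepE.
have gap_gt0 j : 0 < f (x j) - f xs.
  exact: (bfgs_gap_gt0 mu M f xs mu0 M0 fC sc selfc fmin x Bm g0 B0p XS BS).
have D0 : 0 < Delta by exact: (gap_gt0 0).
pose W := invmx (hess f xs).
have Hsp : posdef (hess f xs) := posdef_hess mu f xs fC mu0 sc.
have Wp : posdef W := posdef_invmx _ Hsp.
(* [posdef_sqrt] provides a root, so [sqrtmx] does not return its default value [0]. *)
have HsE : Hs *m Hs = W.
  have [S [Sp SS]] := posdef_sqrt _ _ _ Wp.
  by have [] := @xgetPex _ 0 [set S | posdef S /\ S *m S = W] (ex_intro _ S (conj Sp SS)).
have -> : Psi Btilde0 = Psi (W *m B0) by apply: Psi_sqrt_congr.
have MtE : Mt = L2 / (2 * (mu * Num.sqrt mu)).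
  rewrite /Mt; congr (_ / (_ * _)).
  have -> : 3 / 2 = 1 + 2^-1 :> R by field.
  by rewrite powRD ?gt_eqF ?implybT // powRr1 ?ltW // powR12_sqrt // ltW.
(* Comparing [mu] with [L] takes a nonzero vector; the gradient at [x 0] is one. *)
have kappa1 : 1 <= kappa.
  by rewrite ler_pdivlMr // mul1r; apply: (smoothness_ge_modulus _ _ mu L f (grad f (x 0))).
pose a := M * Num.sqrt Delta.
have a2 : a ^+ 2 = M ^+ 2 * Delta by rewrite exprMn sqr_sqrtr // ltW.
pose Sg := \sum_(j < k) Num.sqrt ((f (x j) - f xs) / Delta).
set T := 2 * Psi Bbar0 + _ + _.
have ST : Sg <= T.
  have -> : T = 2 * Psi Bbar0 + 4 * Num.min ((2 * ln kappa + 1) * a ^+ 2)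
                            (2 * Num.sqrt 2 * kappa * a) + 13 * kappa.
    by rewrite /T a2 /a !mulrA.
  apply: sqrt_gap_budget => //.
  - by rewrite mulr_ge0 ?sqrtr_ge0 // ltW.
  - rewrite /Bbar0 -mul_scalar_mx; apply: Psi_mul_ge0 => //.
    by apply: posdef_scalar; rewrite invr_gt0.
  - move=> l l3; rewrite a2.
    exact: (bfgs_sum_sqrt_gap mu L M f xs mu0 L0 M0 fC sc lip selfc fmin
      x Bm g0 B0p XS BS l k l3).
apply: (gap_product_le _ (fun j => f (x j) - f xs)) => //.
have ratio j := bfgs_gap_ratio mu M L2 f xs mu0 M0 L20 fC sc selfc liph fmin
  x Bm g0 B0p XS BS Mt j MMt MtE.
apply: le_trans (ler_sum _ (fun (j : 'I_k) _ => ratio j)) _.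
rewrite big_split /=; apply: lerD.
  have -> : \sum_(j < k) (Psi (W *m Bm j) - Psi (W *m Bm j.+1)) =
      Psi (W *m B0) - Psi (W *m Bm k).
    elim: (k) => [|m IH]; first by rewrite big_ord0 subrr.
    by rewrite big_ord_recr /= IH addrA subrK.
  rewrite gerBl; apply: Psi_mul_ge0 => //.
  exact: (bfgs_posdef mu M f mu0 M0 fC sc selfc x Bm g0 B0p BS).
have c0 : 0 <= 2 * Num.sqrt 2 * Mt * Num.sqrt Delta.
  have Mt0 : 0 <= Mt by exact: le_trans (ltW M0) MMt.
  by rewrite !(Mt0, sqrtr_ge0, ler0n, mulr_ge0).
have -> : \sum_(j < k) 3 * (2 * Num.sqrt 2 * Mt * Num.sqrt (f (x j) - f xs)) =
   2 * Num.sqrt 2 * Mt * Num.sqrt Delta * (3 * Sg).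
  rewrite /Sg !mulr_sumr; apply: eq_bigr => j _.
  rewrite -{1}(divfK (lt0r_neq0 D0) (f (x j) - f xs)) sqrtrM ?divr_ge0 ?ltW //.
  ring.
(* The sum of the errors carries the constant [6 sqrt 2]; it is relaxed to [8 sqrt 2] through
   [3 <= 4]. *)
have -> : 8 * Num.sqrt 2 * Mt * Num.sqrt Delta * T =
    2 * Num.sqrt 2 * Mt * Num.sqrt Delta * (4 * T) by ring.
apply: ler_wpM2l => //.
have Sg0 : 0 <= Sg by apply: sumr_ge0 => j _; exact: sqrtr_ge0.
by apply: ler_pM => //; rewrite ler_nat.
Qed.
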